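(* Let $K$ be a nonrational function field of genus zero with full constant field $k$, let $\infty$ be a place of $K$ of degree $2$, let $\mathcal{C}$ be the ring of elements of $K$ integral outside $\infty$, let $G=GL_2(\mathcal{C})$, and let $\mathcal{T}$ be the Bruhat-Tits tree of $GL_2(K_\infty)$. Let $v_*=v(\pi,t)$ with $t=y/x$, and $v_n=v(\pi^{-n},0)$ for $n\ge 0$. Then the infinite path in $\mathcal{T}$ (without backtracking) with successive vertices $$v_*,\ v_0,\ v_1,\ v_2,\ \ldots$$ is isomorphic (as a graph) to the quotient graph $G\backslash\mathcal{T}$.
   Context: $K$ is an algebraic function field of one variable with full constant field $k$, of genus zero and nonrational (not a rational function field over $k$; equivalently, $K$ has no place of degree $1$). $\infty$ is a fixed place of $K$ of degree $2$, $\nu$ its normalized discrete valuation, $\pi\in K$ a local parameter ($\nu(\pi)=1$), $\mathcal{O}$ the valuation ring of $\infty$ in $K$, $K_\infty$ and $\mathcal{O}_\infty$ the completions of $K$ and $\mathcal{O}$ at $\infty$. $\mathcal{C}=\{z\in K:\nu_P(z)\ge 0 \text{ for all places } P\ne\infty\}$. It is known that there are $x,y\in K$ with $\nu(x)=\nu(y)=-1$ and $\mathcal{C}=k[x,y]$, satisfying one of the following with $\rho,\sigma\in k^*$: if $\mathrm{char}(k)\ne 2$, (i) $y^2+\rho x^2+\sigma=0$; if $\mathrm{char}(k)=2$, (ii) $y^2+\rho x^2+\sigma=0$, or (iii) $y^2+\rho x^2+x+\sigma=0$, or (iv) $y^2+xy+\rho x^2+\sigma=0$. The equation has no solutions in $k$;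 in cases (i), (ii), (iii) $-\rho$ is a non-square in $k$, and in case (iv) $\rho$ is not of the form $\alpha^2+\alpha$ with $\alpha\in k$. Fix such $x,y$ and put $t=y/x$. The tree $\mathcal{T}$: its vertices are the left cosets of $ZGL_2(\mathcal{O}_\infty)$ in $GL_2(K_\infty)$, $Z$ being the group of scalar matrices. Two vertices $g_1ZGL_2(\mathcal{O}_\infty)$, $g_2ZGL_2(\mathcal{O}_\infty)$ are adjacent iff $g_2^{-1}g_1\in \begin{pmatrix}\pi & z\\0&1\end{pmatrix}ZGL_2(\mathcal{O}_\infty)$ for some $z\in\mathcal{O}$, or $g_2^{-1}g_1\in\begin{pmatrix}\pi^{-1}&0\\0&1\end{pmatrix}ZGL_2(\mathcal{O}_\infty)$. $v(\pi^n,z)$ denotes the vertex represented by $\begin{pmatrix}\pi^n&z\\0&1\end{pmatrix}$ ($n\in\mathbb{Z}$, $z\in K_\infty$). $G$ acts on $\mathcal{T}$ by left multiplication, without inversion. *)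

(* Defs.v *)
From HB Require Import structures.
From mathcomp Require Export all_boot all_order all_algebra.
From mathcomp Require Export boolp classical_sets functions cardinality fsbigop.

Set Implicit Arguments.
Unset Strict Implicit.
Unset Printing Implicit Defensive.

Import Order.TTheory GRing.Theory Num.Theory.
Local Open Scope classical_set_scope.
Local Open Scope ring_scope.

(* Normalized discrete valuations.  The value at 0 is a dummy, fixed to 0 so
   that two valuations agreeing on nonzero elements are equal as functions;
   [val_ge] and [val_ring] below implement the convention nu(0) = +oo. *)
Record discrete_valuation (F : fieldType) (nu : F -> int) : Prop :=
  DiscreteValuation {
    dval0 : nu 0 = 0;
    dvalM : forall a b, a != 0 -> b != 0 -> nu (a * b) = nu a + nu b;
    dvalD : forall a b, a != 0 -> b != 0 -> a + b != 0 ->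
      Num.min (nu a) (nu b) <= nu (a + b);
    dval_normalized : exists a, nu a = 1
  }.

Definition val_ge (F : fieldType) (nu : F -> int) (n : int) : set F :=
  [set z | z = 0 \/ n <= nu z].

Definition val_ring (F : fieldType) (nu : F -> int) : set F := val_ge nu 0.
Definition val_ideal (F : fieldType) (nu : F -> int) : set F := val_ge nu 1.

(* The completion of (K, nu), up to unique isomorphism: a complete discretely
   valued field containing K as a dense valued subfield. *)
Record is_completion (K : fieldType) (nu : K -> int) (Kinf : fieldType)
    (nuinf : Kinf -> int) (j : {rmorphism K -> Kinf}) : Prop := IsCompletion {
  compl_valuation : discrete_valuation nuinf;
  compl_extends : forall z, nuinf (j z) = nu z;
  compl_dense : forall (w : Kinf) (n : int),
    exists z : K, val_ge nuinf n (w - j z);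
  compl_complete : forall u : nat -> Kinf,
    (forall n : int, exists m : nat, forall a b : nat,
       (m <= a)%N -> (m <= b)%N -> val_ge nuinf n (u a - u b)) ->
    exists w : Kinf, forall n : int, exists m : nat, forall a : nat,
      (m <= a)%N -> val_ge nuinf n (u a - w)
}.

Section FunctionField.
Variables (k K : fieldType) (iota : {rmorphism k -> K}).

Definition rational_in (x : K) : set K :=
  [set z | exists p q : {poly k}, (map_poly iota q).[x] != 0 /\
     z = (map_poly iota p).[x] / (map_poly iota q).[x]].

Definition function_field : Prop :=
  exists x : K, ~ algebraicOver iota x /\
  exists (n : nat) (b : 'I_n -> K), forall z : K,
  exists c : 'I_n -> K, (forall i, rational_in x (c i)) /\
    z = \sum_(i < n) c i * b i.

Definition full_constant_field : Prop :=
  forall z : K, algebraicOver iota z -> exists a : k, z = iota a.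

Definition rational_function_field : Prop :=
  exists x : K, ~ algebraicOver iota x /\ forall z, rational_in x z.

(* Places of K/k, represented by their normalized discrete valuations. *)
Record place := Place {
  pval :> K -> int;
  pval_valuation : discrete_valuation pval;
  pval_const : forall a : k, pval (iota a) = 0
}.

HB.instance Definition _ := gen_eqMixin place.
HB.instance Definition _ := gen_choiceMixin place.

(* V / W has dimension n over k, for k-subspaces W of V of K. *)
Definition has_quot_dim (V W : set K) (n : nat) : Prop :=
  exists b : 'I_n -> K, (forall i, V (b i)) /\
    forall z, V z ->
      exists! c : 'rV[k]_n, W (z - \sum_(i < n) iota (c 0 i) * b i).

(* Dummy value 0 when the dimension is infinite. *)
Definition quot_dim (V W : set K) : nat := xget 0%N (has_quot_dim V W).

Definition place_degree (P : place) : nat :=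
  quot_dim (val_ring P) (val_ideal P).

Definition is_divisor (D : place -> int) : Prop :=
  finite_set [set P | D P <> 0].

Definition divisor_degree (D : place -> int) : int :=
  \sum_(P \in [set: place]) D P * (place_degree P)%:Z.

Definition RR_space (D : place -> int) : set K :=
  [set f | forall P : place, val_ge P (- D P) f].

Definition RR_dim (D : place -> int) : nat := quot_dim (RR_space D) [set 0].

(* g is the maximum of deg D - l(D) + 1 over all divisors D. *)
Definition has_genus (g : int) : Prop :=
  (forall D, is_divisor D -> divisor_degree D - (RR_dim D)%:Z + 1 <= g) /\
  (exists D, is_divisor D /\ divisor_degree D - (RR_dim D)%:Z + 1 = g).

Definition integral_outside (infty : place) : set K :=
  [set z | forall P : place, P <> infty -> val_ring P z].

Definition poly_ring_in (x y : K) : set K :=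
  [set z | exists p : {poly {poly k}},
     z = (map_poly (map_poly iota) p).[x%:P].[y]].

(* The shapes Y^2 + rho X^2 + sigma (any characteristic),
   Y^2 + rho X^2 + X + sigma and Y^2 + XY + rho X^2 + sigma
   (characteristic 2). *)
Inductive conic_shape := ConicDiag | ConicLin | ConicMixed.

Definition conic (R : comNzRingType) (s : conic_shape) (rho sigma X Y : R) : R :=
  match s with
  | ConicDiag => Y ^+ 2 + rho * X ^+ 2 + sigma
  | ConicLin => Y ^+ 2 + rho * X ^+ 2 + X + sigma
  | ConicMixed => Y ^+ 2 + X * Y + rho * X ^+ 2 + sigma
  end.

Definition conic_condition (s : conic_shape) (rho : k) : Prop :=
  match s with
  | ConicDiag => ~ exists a : k, - rho = a ^+ 2
  | ConicLin => 2%N \in [pchar k] /\ ~ exists a : k, - rho = a ^+ 2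
  | ConicMixed => 2%N \in [pchar k] /\ ~ exists a : k, rho = a ^+ 2 + a
  end.

Definition conic_generators (infty : place) (x y : K) : Prop :=
  [/\ infty x = -1, infty y = -1,
      integral_outside infty = poly_ring_in x y &
      exists (s : conic_shape) (rho sigma : k),
        [/\ rho != 0, sigma != 0, conic_condition s rho,
            conic s (iota rho) (iota sigma) x y = 0 &
            ~ exists a b : k, conic s rho sigma a b = 0]].

End FunctionField.

(* Multigraphs: an (unoriented) edge has a set of endpoints, with two elements,
   or one if the edge is a loop. *)
Record graph := Graph {
  vertex : Type;
  edge : Type;
  vertices : set vertex;
  edges : set edge;
  ends : edge -> set vertex
}.
Arguments vertices : clear implicits.
Arguments edges : clear implicits.

Definition graph_isomorphism (X Y : graph)
    (f : vertex X -> vertex Y) (h : edge X -> edge Y) : Prop :=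
  [/\ set_bij (vertices X) (vertices Y) f,
      set_bij (edges X) (edges Y) h &
      forall e, edges X e -> ends (h e) = f @` ends e].

(* A simple graph: edges are the given sets {u, v} of vertices. *)
Definition simple_graph (V : Type) (vs : set V) (es : set (set V)) : graph :=
  @Graph V (set V) vs es id.

Definition infinite_path (V : Type) (es : set (set V)) (p : nat -> V) : Prop :=
  forall n, es [set p n; p n.+1].

Definition without_backtracking (V : Type) (p : nat -> V) : Prop :=
  forall n, p n <> p n.+2.

Definition path_graph (V : Type) (p : nat -> V) : graph :=
  simple_graph (range p) (range (fun n => [set p n; p n.+1])).

(* The quotient of the simple graph (vs, es) by the action [act] of a group
   A: its vertices and edges are the A-orbits of vertices and edges, and the
   endpoints of the orbit of {u, v} are the orbits of u and v. *)
Section QuotientGraph.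
Variables (A V : Type) (grp : set A) (act : A -> V -> V).

Definition vertex_orbit (v : V) : set V := [set act g v | g in grp].

Definition edge_orbit (e : set V) : set (set V) := [set act g @` e | g in grp].

Definition quotient_graph (vs : set V) (es : set (set V)) : graph :=
  @Graph (set V) (set (set V)) (vertex_orbit @` vs) (edge_orbit @` es)
    (fun O => [set vertex_orbit v | v in \bigcup_(e in O) e]).
End QuotientGraph.

Definition GL2 (F : fieldType) (S : set F) : set 'M[F]_2 :=
  [set g | [/\ g \in unitmx, forall i j, S (g i j)
             & forall i j, S (invmx g i j)]].

(* The matrix (a z; 0 1). *)
Definition affine_mx (F : fieldType) (a z : F) : 'M[F]_2 :=
  (block_mx a%:M z%:M 0 1%:M : 'M_(1 + 1)).

Section Tree.
Variables (K : fieldType) (nu : K -> int) (pi : K).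
Variables (Kinf : fieldType) (nuinf : Kinf -> int) (j : {rmorphism K -> Kinf}).

Definition ZGL2_Oinf : set 'M[Kinf]_2 :=
  [set c *: h | c in [set c : Kinf | c != 0] & h in GL2 (val_ring nuinf)].

Definition coset_mx (g : 'M[Kinf]_2) : set 'M[Kinf]_2 :=
  [set g *m h | h in ZGL2_Oinf].

(* Vertices of the tree are cosets, i.e. sets of matrices. *)
Definition tree_vertices : set (set 'M[Kinf]_2) :=
  [set coset_mx g | g in GL2 [set: Kinf]].

Definition adjacent_mx (g1 g2 : 'M[Kinf]_2) : Prop :=
  (exists z : K, val_ring nu z /\
     coset_mx (affine_mx (j pi) (j z)) (invmx g2 *m g1)) \/
  coset_mx (affine_mx (j pi)^-1 0) (invmx g2 *m g1).

Definition tree_edges : set (set (set 'M[Kinf]_2)) :=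
  [set e | exists g1 g2, [/\ GL2 [set: Kinf] g1, GL2 [set: Kinf] g2,
     adjacent_mx g1 g2 & e = [set coset_mx g1; coset_mx g2]]].

Definition tree_act (g : 'M[K]_2) (v : set 'M[Kinf]_2) : set 'M[Kinf]_2 :=
  [set map_mx j g *m a | a in v].

Definition tree_v (n : int) (z : Kinf) : set 'M[Kinf]_2 :=
  coset_mx (affine_mx (j pi ^ n) z).

Definition standard_path (t : K) (m : nat) : set 'M[Kinf]_2 :=
  if m is n.+1 then tree_v (- n%:Z) 0 else tree_v 1 (j t).
End Tree.

(* Main.v *)
Require Import Defs.
From mathcomp Require Import ring zify.

Set Implicit Arguments.
Unset Strict Implicit.
Unset Printing Implicit Defensive.

Import Order.TTheory GRing.Theory Num.Theory.
Local Open Scope classical_set_scope.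
Local Open Scope ring_scope.

(* The ring C is k[x] + y k[x], and 1, t form a k-basis of the residue field at
   infinity, so an element of C without pole is a constant.  Looking at the
   determinant and the second row of a matrix of GL_2(C) that would carry one
   vertex of the path to another shows that the path vertices are inequivalent.
   The neighbours of a vertex correspond to the points of the projective line
   over the residue field k + k t.  The stabilizer of v_0 contains GL_2(k), with
   orbit representatives infinity (v_1) and t (v_* ); that of v_n, n > 0, contains
   the unipotent matrices with entry a x^n + b x^(n-1) y, which move all
   neighbours other than v_(n+1) to v_(n-1).  Finally, every neighbour of v_* is
   carried to v_0 by an explicit matrix of C-entries at most linear in x, y, whose
   determinant is a value of the conic equation at a point of k^2, hence a nonzero
   constant.  Connectedness of the tree concludes. *)

(** * Discrete valuations, with 0 counted as having infinite value *)

Section Valuation.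
Variables (F : fieldType) (nu : F -> int) (nuP : discrete_valuation nu).

Lemma dval1 : nu 1 = 0.
Proof.
have := dvalM nuP (oner_neq0 F) (oner_neq0 F); rewrite mulr1 => h.
by move: (nu 1) h => n; lia.
Qed.

Lemma dvalN a : nu (- a) = nu a.
Proof.
have [->|a0] := eqVneq a 0; first by rewrite oppr0.
have N1 : (-1 : F) != 0 by rewrite oppr_eq0 oner_neq0.
have := dvalM nuP N1 N1; rewrite mulrNN mulr1 dval1 => h.
by rewrite -mulN1r dvalM //; lia.
Qed.

(** At 0 the identity rests on two conventions: [0^-1 = 0] and the dummy value [nu 0 = 0]. *)
Lemma dvalV a : nu a^-1 = - nu a.
Proof.
have [->|a0] := eqVneq a 0; first by rewrite invr0 (dval0 nuP) oppr0.
have := dvalM nuP a0 (invr_neq0 a0); rewrite divff // dval1 => h.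
by lia.
Qed.

Lemma dvalX a n : nu (a ^+ n) = n%:Z * nu a.
Proof.
have [->|a0] := eqVneq a 0.
  by rewrite (dval0 nuP) mulr0 expr0n; case: n => [|n]; rewrite ?dval1 ?(dval0 nuP).
elim: n => [|n IHn]; first by rewrite expr0 dval1 mul0r.
by rewrite exprS dvalM ?expf_neq0 // IHn; lia.
Qed.

Lemma dvalXz a (n : int) : nu (a ^ n) = n * nu a.
Proof. by case: n => n; rewrite ?NegzE -?exprnP -?exprnN ?dvalV dvalX //; lia. Qed.

Lemma val_ge0 n : val_ge nu n 0. Proof. by left. Qed.

Lemma val_geP n a : a != 0 -> val_ge nu n a -> n <= nu a.
Proof. by move=> a0 [a_0|//]; rewrite a_0 eqxx in a0. Qed.

Lemma val_geW m n a : m <= n -> val_ge nu n a -> val_ge nu m a.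
Proof. by move=> mn [->|na]; [left|right; exact: le_trans na]. Qed.

Lemma val_geN n a : val_ge nu n a -> val_ge nu n (- a).
Proof. by case=> [->|na]; [left; rewrite oppr0|right; rewrite dvalN]. Qed.

Lemma val_geD n a b : val_ge nu n a -> val_ge nu n b -> val_ge nu n (a + b).
Proof.
have [->|a0] := eqVneq a 0; first by rewrite add0r.
have [->|b0] := eqVneq b 0; first by rewrite addr0.
move=> /(val_geP a0) na /(val_geP b0) nb.
have [->|ab0] := eqVneq (a + b) 0; first exact: val_ge0.
by right; apply: le_trans (dvalD nuP a0 b0 ab0); rewrite le_min na nb.
Qed.

Lemma val_geB n a b : val_ge nu n a -> val_ge nu n b -> val_ge nu n (a - b).
Proof. by move=> na nb; apply: val_geD => //; apply: val_geN. Qed.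

Lemma val_geM m n l a b :
  l <= m + n -> val_ge nu m a -> val_ge nu n b -> val_ge nu l (a * b).
Proof.
have [->|a0] := eqVneq a 0; first by rewrite mul0r => *; apply: val_ge0.
have [->|b0] := eqVneq b 0; first by rewrite mulr0 => *; apply: val_ge0.
move=> lmn /(val_geP a0) na /(val_geP b0) nb.
by right; rewrite dvalM //; lia.
Qed.

Lemma val_ge_sum (I : Type) (r : seq I) (f : I -> F) n :
  (forall i, val_ge nu n (f i)) -> val_ge nu n (\sum_(i <- r) f i).
Proof.
by move=> nf; elim/big_ind: _ => //; [exact: val_ge0|exact: val_geD].
Qed.

Lemma val_ge_nu a : val_ge nu (nu a) a. Proof. by right. Qed.

End Valuation.

(** * Two by two matrices in coordinates *)

Section Matrix2.
Variable F : fieldType.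
Implicit Types (a b c d : F) (M : 'M[F]_2).

Definition mx2 a b c d : 'M[F]_2 :=
  \matrix_(i, j) if i == 0 then (if j == 0 then a else b)
                 else (if j == 0 then c else d).

Lemma ord2P (P : 'I_2 -> Prop) : P 0 -> P 1 -> forall i, P i.
Proof.
by move=> P0 P1 [[|[|//]] ilt]; [move: P0|move: P1]; congr P; apply: val_inj.
Qed.

Lemma mx2E a b c d :
  (mx2 a b c d 0 0 = a) * (mx2 a b c d 0 1 = b) *
  (mx2 a b c d 1 0 = c) * (mx2 a b c d 1 1 = d).
Proof. by rewrite !mxE. Qed.

Lemma mx2_eta M : M = mx2 (M 0 0) (M 0 1) (M 1 0) (M 1 1).
Proof. by apply/matrixP; apply: ord2P; apply: ord2P; rewrite mx2E. Qed.

Lemma mul_mx2 a b c d a' b' c' d' :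
  mx2 a b c d *m mx2 a' b' c' d' =
  mx2 (a * a' + b * c') (a * b' + b * d') (c * a' + d * c') (c * b' + d * d').
Proof.
apply/matrixP; apply: ord2P; apply: ord2P;
  by rewrite mxE !big_ord_recl big_ord0 addr0 !mxE.
Qed.

Lemma det_mx2 M : \det M = M 0 0 * M 1 1 - M 0 1 * M 1 0.
Proof.
rewrite (expand_det_row _ 0) !big_ord_recl big_ord0 addr0 /cofactor !det_mx11.
rewrite !mxE /= expr0 mul1r expr1 mulN1r mulrN.
by congr (M _ _ * M _ _ - M _ _ * M _ _); apply: val_inj.
Qed.

Lemma mx2_1 : 1%:M = mx2 1 0 0 1.
Proof. by apply/matrixP; apply: ord2P; apply: ord2P; rewrite mx2E !mxE. Qed.

Lemma affine_mxE a z : affine_mx a z = mx2 a z 0 1.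
Proof.
(* [affine_mx] is a block matrix of size 1 + 1, so its indices are first presented as [lshift] and
   [rshift]. *)
have E0 : 0 = lshift 1 0 :> 'I_(1 + 1) by apply: val_inj.
have E1 : 1 = rshift 1 0 :> 'I_(1 + 1) by apply: val_inj.
apply/matrixP; apply: ord2P; apply: ord2P;
  rewrite mx2E -[affine_mx _ _]/(block_mx _ _ _ _) ?E0 ?E1.
- by apply: etrans (block_mxEul _ _ _ _ 0 0) _; rewrite mxE.
- by apply: etrans (block_mxEur _ _ _ _ 0 0) _; rewrite mxE.
- by apply: etrans (block_mxEdl _ _ _ _ 0 0) _; rewrite mxE.
- by apply: etrans (block_mxEdr _ _ _ _ 0 0) _; rewrite mxE.
Qed.

Lemma unitmx2 M : (M \in unitmx) = (\det M != 0).
Proof. by rewrite unitmxE unitfE. Qed.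

Lemma invmx2 M : M \in unitmx ->
  invmx M = mx2 (M 1 1 / \det M) (- M 0 1 / \det M)
                (- M 1 0 / \det M) (M 0 0 / \det M).
Proof.
move=> uM; have d0 : \det M != 0 by rewrite -unitmx2.
apply: (can_inj (mulKmx uM)); rewrite mulmxV // mx2_1.
have := mul_mx2 (M 0 0) (M 0 1) (M 1 0) (M 1 1); rewrite -mx2_eta => ->.
by rewrite det_mx2 in d0 *; congr mx2; field.
Qed.

End Matrix2.

Lemma map_mx2 (F F' : fieldType) (f : {rmorphism F -> F'}) (a b c d : F) :
  map_mx f (mx2 a b c d) = mx2 (f a) (f b) (f c) (f d).
Proof. by apply/matrixP; apply: ord2P; apply: ord2P; rewrite mxE !mx2E. Qed.

(** * Vertices and adjacency through matrices that are integral up to scaling *)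

Section ScaledIntegral.
Variables (F : fieldType) (nu : F -> int) (nuP : discrete_valuation nu).
Implicit Types (a b c d z : F) (e n : int) (g h M : 'M[F]_2).

(* [scaled_int 0] is Z GL_2(O), and the cosets of [g1] and [g2] are adjacent iff
   [invmx g2 *m g1] lies in [scaled_int 1]. *)
Definition scaled_int e : set 'M[F]_2 :=
  [set M | M \in unitmx /\ exists n, nu (\det M) = n + n + e /\
     forall i j, val_ge nu n (M i j)].

Lemma scaled_intP e n a b c d : a * d - b * c != 0 ->
  nu (a * d - b * c) = n + n + e -> val_ge nu n a -> val_ge nu n b ->
  val_ge nu n c -> val_ge nu n d -> scaled_int e (mx2 a b c d).
Proof.
move=> D0 nuD na nb nc nd; rewrite /scaled_int /= unitmx2 det_mx2 !mx2E.
by split=> //; exists n; split=> //; apply: ord2P; apply: ord2P; rewrite mx2E.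
Qed.

Lemma scaled_intM e e' M N :
  scaled_int e M -> scaled_int e' N -> scaled_int (e + e') (M *m N).
Proof.
move=> [uM [m [dM vM]]] [uN [n [dN vN]]].
split; first by rewrite unitmx_mul uM.
exists (m + n); split.
  rewrite unitmx2 in uM; rewrite unitmx2 in uN.
  by rewrite det_mulmx dvalM // dM dN; lia.
by move=> i l; rewrite mxE; apply: val_ge_sum => // s; apply: val_geM (vM _ _) (vN _ _).
Qed.

(** With entries of value at least m and determinant of value 2m + e, the adjugate formula bounds
    the inverse by m - (2m + e) = - m - e. Since - (2m + e) = 2 (- m - e) + e, the same [e]
    serves. *)
Lemma scaled_intV e M : scaled_int e M -> scaled_int e (invmx M).
Proof.
move=> [uM [m [dM vM]]]; split; first by rewrite unitmx_inv.
exists (- m - e); split; first by rewrite det_inv dvalV // dM; lia.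
rewrite invmx2 //.
have dV : val_ge nu (- (m + m + e)) (\det M)^-1 by right; rewrite dvalV // dM.
have le : - m - e <= m + (- (m + m + e)) by lia.
by apply: ord2P; apply: ord2P; rewrite mx2E;
  apply: (val_geM nuP le) => //; try apply: val_geN => //.
Qed.

Lemma scaled_int_affine a z : a != 0 -> val_ge nu (nu a) z -> nu a <= 0 ->
  scaled_int (- nu a) (affine_mx a z).
Proof.
move=> a0 vz na; rewrite affine_mxE; apply: (@scaled_intP _ (nu a)).
- by rewrite mulr1 mulr0 subr0.
- by rewrite mulr1 mulr0 subr0; lia.
- exact: val_ge_nu.
- exact: vz.
- exact: val_ge0.
- by right; rewrite dval1.
Qed.

Lemma scaled_int1 : scaled_int 0 1%:M.
Proof.
have nu1 := dval1 nuP; rewrite mx2_1; apply: (@scaled_intP _ 0);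
  rewrite ?mulr0 ?subr0 ?mulr1 ?oner_neq0 //; try exact: val_ge0; by right; rewrite nu1.
Qed.

Lemma scaled_intZ e c M : c != 0 -> scaled_int e M -> scaled_int e (c *: M).
Proof.
move=> c0 [uM [m [dM vM]]]; rewrite unitmx2 in uM; split.
  by rewrite unitmx2 detZ mulf_neq0 // expf_neq0.
exists (nu c + m); split.
  by rewrite detZ dvalM ?expf_neq0 // dvalX // dM; lia.
by move=> i l; rewrite mxE; apply: val_geM (val_ge_nu nu c) (vM i l).
Qed.

Lemma affine_mx_unit a z : a != 0 -> affine_mx a z \in unitmx.
Proof. by move=> a0; rewrite affine_mxE unitmx2 det_mx2 !mx2E mulr1 mulr0 subr0. Qed.

Lemma invmx_affine a z : a != 0 -> invmx (affine_mx a z) = affine_mx a^-1 (- (z / a)).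
Proof.
move=> a0; rewrite invmx2 ?affine_mx_unit // det_mx2 affine_mxE !mx2E.
by rewrite affine_mxE; congr mx2; field.
Qed.

Lemma mul_affine a z b w :
  affine_mx a z *m affine_mx b w = affine_mx (a * b) (a * w + z).
Proof. by rewrite !affine_mxE mul_mx2; congr mx2; ring. Qed.

Variables (pi : F) (nu_pi : nu pi = 1).

Lemma uniformizer_neq0 : pi != 0.
Proof. by apply/eqP => pi0; move: nu_pi; rewrite pi0 (dval0 nuP). Qed.

Let pi0 := uniformizer_neq0.

(** For [h] in GL_2(O) the determinant and its inverse are both integral, so the determinant is a
    unit. Conversely, dividing by pi^n leaves an integral matrix whose determinant is a unit, hence
    with integral inverse. *)
Lemma scaled_int0E : ZGL2_Oinf nu = scaled_int 0.
Proof.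
apply/seteqP; split => [_ [c c0 [h [uh vh vh'] <-]]|M [uM [n [dM vM]]]].
  apply: scaled_intZ => //; split=> //; exists 0; split=> //.
  have det_int (N : 'M[F]_2) : (forall i l, val_ge nu 0 (N i l)) -> val_ge nu 0 (\det N).
    move=> vN; rewrite det_mx2; apply: val_geB => //;
    exact: (val_geM nuP _ (vN _ _) (vN _ _)).
  have dh : val_ge nu 0 (\det h) by exact: det_int vh.
  have dh' : val_ge nu 0 (\det (invmx h)) by exact: det_int vh'.
  rewrite det_inv in dh'; rewrite unitmx2 in uh.
  have := val_geP uh dh; have := val_geP (invr_neq0 uh) dh'.
  by rewrite dvalV //; move: (nu (\det h)) => m; lia.
have pn0 m : pi ^ m != 0 by rewrite expfz_neq0.
exists (pi ^ n); first exact: pn0.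
exists ((pi ^ n)^-1 *: M); last by rewrite scalerA divff ?scale1r.
have nuZ : nu (pi ^ n)^-1 = - n by rewrite dvalV // dvalXz // nu_pi; lia.
split.
- by rewrite unitmxZ // unitfE invr_neq0.
- move=> i l; rewrite mxE; apply: (@val_geM _ _ nuP (- n) n); [by lia| |exact: vM].
  by right; rewrite nuZ.
- have uM' := uM; rewrite unitmx2 in uM'.
  have dV : val_ge nu (- n - n) (\det M)^-1.
    by right; rewrite dvalV // dM; lia.
  have le : - n <= n + (- n - n) by lia.
  have pV : val_ge nu n (pi ^ n) by right; rewrite dvalXz // nu_pi; lia.
  rewrite invmxZ ?invrK; last by rewrite unitmxZ // unitfE invr_neq0.
  move=> i l; rewrite mxE; apply: (@val_geM _ _ nuP n (- n)) => //; first by lia.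
  move: i l; rewrite invmx2 //; apply: ord2P; apply: ord2P; rewrite mx2E;
  by apply: (val_geM nuP le) => //; try apply: val_geN => //.
Qed.

Lemma coset_mxP g g' : coset_mx nu g g' <-> exists2 h, scaled_int 0 h & g' = g *m h.
Proof.
by rewrite /coset_mx scaled_int0E; split=> -[h ? ?]; exists h.
Qed.

Lemma coset_mx_mulr g h : scaled_int 0 h -> coset_mx nu (g *m h) = coset_mx nu g.
Proof.
move=> sh; apply/seteqP; split=> g' /coset_mxP[h' sh' ->]; apply/coset_mxP.
  by exists (h *m h'); rewrite ?mulmxA //; apply: (scaled_intM sh sh').
exists (invmx h *m h'); first exact: (scaled_intM (scaled_intV sh) sh').
by case: sh => uh _; rewrite !mulmxA mulmxK.
Qed.

Lemma coset_mx_refl g : coset_mx nu g g.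
Proof. by apply/coset_mxP; exists 1%:M; rewrite ?mulmx1 //; apply: scaled_int1. Qed.

Lemma coset_mx_eqP g g' :
  coset_mx nu g' = coset_mx nu g <-> exists2 h, scaled_int 0 h & g' = g *m h.
Proof.
split=> [E|[h sh ->]]; last exact: coset_mx_mulr.
by apply/coset_mxP; rewrite -E; apply: coset_mx_refl.
Qed.

(** The two representatives differ by an upper triangular matrix with unit diagonal and integral
    corner. *)
Lemma coset_affine_eq a z a' z' : a != 0 -> a' != 0 -> nu a = nu a' ->
  val_ge nu (nu a) (z - z') -> coset_mx nu (affine_mx a z) = coset_mx nu (affine_mx a' z').
Proof.
move=> a0 a'0 naa' vz; apply/coset_mx_eqP; exists (affine_mx (a / a') ((z - z') / a')).
  rewrite -oppr0; have n0 : nu (a / a') = 0.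
    by rewrite dvalM ?invr_neq0 // dvalV // naa'; lia.
  rewrite -n0; apply: scaled_int_affine; rewrite ?n0 //.
    by rewrite mulf_neq0 ?invr_neq0.
  apply: (@val_geM _ _ nuP (nu a) (- nu a)); rewrite ?subrr //.
  by right; rewrite dvalV // naa'.
by rewrite mul_affine; congr affine_mx; field.
Qed.

(** This lists the neighbours of a vertex. Divided by pi^n, [M] is integral and singular modulo pi.
    If its bottom row is nonzero modulo pi, the top row is z times the bottom one there; a zero
    bottom row gives the one remaining neighbour. *)
Lemma scaled_int1_affine M : scaled_int 1 M ->
  (exists2 h, scaled_int 0 h & M = affine_mx pi^-1 0 *m h) \/
  exists z, val_ge nu 0 z /\ exists2 h, scaled_int 0 h & M = affine_mx pi z *m h.
Proof.
move=> [uM [n [dM vM]]]; have uM' := uM; rewrite unitmx2 in uM'.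
rewrite det_mx2 in dM uM'.
move: (mx2_eta M) (vM 0 0) (vM 0 1) (vM 1 0) (vM 1 1) dM uM' => ->.
rewrite !mx2E.
move: (M 0 0) (M 0 1) (M 1 0) (M 1 1) => a b c d va vb vc vd nD D0 {M vM uM}.
have piV : nu pi^-1 = -1 by rewrite dvalV // nu_pi.
(* Subtracting z times the bottom row leaves a top row that can be divided by pi. *)
have key z : val_ge nu (n + 1) (a - z * c) -> val_ge nu (n + 1) (b - z * d) ->
    exists2 h, scaled_int 0 h & mx2 a b c d = affine_mx pi z *m h.
  move=> v1 v2; exists (mx2 ((a - z * c) / pi) ((b - z * d) / pi) c d); last first.
    by rewrite affine_mxE mul_mx2; congr mx2; field.
  have E : (a - z * c) / pi * d - (b - z * d) / pi * c = (a * d - b * c) / pi by field.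
  apply: (@scaled_intP _ n); rewrite ?E.
  - by rewrite mulf_neq0 ?invr_neq0.
  - by rewrite dvalM ?invr_neq0 // piV nD; lia.
  - by apply: (@val_geM _ _ nuP (n + 1) (-1)); [lia|exact: v1|right; rewrite piV].
  - by apply: (@val_geM _ _ nuP (n + 1) (-1)); [lia|exact: v2|right; rewrite piV].
  - by apply: val_geW vc; lia.
  - by apply: val_geW vd; lia.
(* If [d] has value exactly n, then z = b / d clears the top right entry, and the top left one
   becomes the determinant divided by [d], of value n + 1. The case of [c] is symmetric. *)
have [/= vd1|nvd1] := pselect (val_ge nu (n + 1) d); last first.
  have d0 : d != 0 by apply/eqP=> d0; apply: nvd1; left.
  have nd : nu d = n.
    have := val_geP d0 vd; suff : ~ (n + 1 <= nu d) by lia.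
    by move=> h; apply: nvd1; right.
  right; exists (b / d); split.
    by apply: (@val_geM _ _ nuP n (- n)) => //; [lia|right; rewrite dvalV // nd].
  apply: key; last by left; field.
  have -> : a - b / d * c = (a * d - b * c) / d by field.
  by right; rewrite dvalM ?invr_neq0 // dvalV // nd nD; lia.
have [/= vc1|nvc1] := pselect (val_ge nu (n + 1) c); last first.
  have c0 : c != 0 by apply/eqP=> c0; apply: nvc1; left.
  have nc : nu c = n.
    have := val_geP c0 vc; suff : ~ (n + 1 <= nu c) by lia.
    by move=> h; apply: nvc1; right.
  right; exists (a / c); split.
    by apply: (@val_geM _ _ nuP n (- n)) => //; [lia|right; rewrite dvalV // nc].
  apply: key; first by left; field.
  have -> : b - a / c * d = - ((a * d - b * c) / c) by field.
  by right; rewrite dvalN // dvalM ?invr_neq0 // dvalV // nc nD; lia.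
(* Both bottom entries now have value at least n + 1. Multiplying the top row by pi raises the value
   of the determinant to 2 (n + 1). *)
left; exists (mx2 (pi * a) (pi * b) c d); last first.
  by rewrite affine_mxE mul_mx2; congr mx2; field.
have E : pi * a * d - pi * b * c = pi * (a * d - b * c) by ring.
apply: (@scaled_intP _ (n + 1)) => //; rewrite ?E.
- by rewrite mulf_neq0.
- by rewrite dvalM // nu_pi nD; lia.
- by apply: (@val_geM _ _ nuP 1 n); [lia|right; rewrite nu_pi|].
- by apply: (@val_geM _ _ nuP 1 n); [lia|right; rewrite nu_pi|].
Qed.

(* Connectedness of the tree, in group-theoretic terms. *)
Lemma unitmx_generated (P : set 'M[F]_2) :
  (forall g h, P g -> P h -> P (g *m h)) -> scaled_int 0 `<=` P ->
  scaled_int 1 `<=` P -> forall g, g \in unitmx -> P g.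
Proof.
move=> PM P0 P1.
have nu1 := dval1 nuP.
have v1 : val_ge nu 0 1 by right; rewrite nu1.
have swapP : P (mx2 0 1 1 0).
  apply: P0; apply: (@scaled_intP _ 0) => //; try exact: val_ge0.
    by rewrite mul0r mul1r sub0r oppr_eq0 oner_neq0.
  by rewrite mul0r mul1r sub0r dvalN.
(* Each factor pi or pi^-1 brings the value of [a] one step closer to 0, where the matrix lies in
   [scaled_int 0]. *)
have diagP a : a != 0 -> P (affine_mx a 0).
  have [m] := ubnP `|nu a|%N; elim: m a => // m IHm a nam a0.
  have piV : nu pi^-1 = -1 by rewrite dvalV // nu_pi.
  have [na|[na|na]] : nu a < 0 \/ nu a = 0 \/ 0 < nu a by lia.
  - have -> : affine_mx a 0 = affine_mx (a * pi) 0 *m affine_mx pi^-1 0.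
      by rewrite mul_affine; congr affine_mx; field.
    apply: (PM); first by apply: IHm; rewrite ?mulf_neq0 // dvalM // nu_pi; lia.
    apply: P1; have -> : 1 = - nu pi^-1 by rewrite piV.
    apply: scaled_int_affine; rewrite ?invr_neq0 ?piV //; exact: val_ge0.
  - apply: P0; rewrite -oppr0 -na; apply: scaled_int_affine; rewrite ?na //.
    exact: val_ge0.
  - have -> : affine_mx a 0 = affine_mx (a / pi) 0 *m affine_mx pi 0.
      by rewrite mul_affine; congr affine_mx; field.
    apply: (PM).
      by apply: IHm; rewrite ?mulf_neq0 ?invr_neq0 // dvalM ?invr_neq0 // piV; lia.
    apply: P1; rewrite affine_mxE; apply: (@scaled_intP _ 0) => //;
      rewrite ?mulr0 ?mulr1 ?subr0 ?nu_pi //; try exact: val_ge0.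
    by right; rewrite nu_pi.
(* Conjugation by a diagonal matrix reduces the corner entry to 1. *)
have upperP z : P (affine_mx 1 z).
  have [->|z0] := eqVneq z 0; first by apply: diagP; apply: oner_neq0.
  have -> : affine_mx 1 z = affine_mx z 0 *m affine_mx 1 1 *m affine_mx z^-1 0.
    by rewrite !mul_affine; congr affine_mx; field.
  apply: (PM); last by apply: diagP; rewrite invr_neq0.
  apply: (PM); first exact: diagP.
  apply: P0; rewrite -oppr0 -nu1; apply: scaled_int_affine; rewrite ?nu1 ?oner_neq0 //.
have lowerP z : P (mx2 1 0 z 1).
  have -> : mx2 1 0 z 1 = mx2 0 1 1 0 *m affine_mx 1 z *m mx2 0 1 1 0.
    by rewrite affine_mxE !mul_mx2; congr mx2; ring.
  by apply: (PM) => //; apply: (PM).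
(* A nonzero lower right entry [d] allows the factorization into upper unipotent, diagonal and lower
   unipotent parts; the diagonal part is the scalar [d] times an [affine_mx]. *)
have main g : g \in unitmx -> g 1 1 != 0 -> P g.
  rewrite unitmx2 det_mx2; move: (mx2_eta g).
  move: (g 0 0) (g 0 1) (g 1 0) (g 1 1) => a b c d -> D0 d0.
  have -> : mx2 a b c d = affine_mx 1 (b / d) *m (mx2 d 0 0 d *m
      affine_mx ((a * d - b * c) / d / d) 0) *m mx2 1 0 (c / d) 1.
    by rewrite !affine_mxE !mul_mx2; congr mx2; field.
  apply: (PM) => //; apply: (PM) => //; apply: (PM); last first.
    by apply: diagP; rewrite !mulf_neq0 ?invr_neq0.
  apply: P0; apply: (@scaled_intP _ (nu d)); rewrite ?mulr0 ?subr0.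
  - by rewrite mulf_neq0.
  - by rewrite dvalM // addr0.
  - exact: val_ge_nu.
  - exact: val_ge0.
  - exact: val_ge0.
  - exact: val_ge_nu.
(* If the lower right entry is 0, exchanging the columns makes it nonzero. *)
move=> g ug; have [d0|] := eqVneq (g 1 1) 0; last exact: main.
have sK : mx2 0 1 1 0 *m mx2 0 1 1 0 = 1%:M :> 'M[F]_2.
  by rewrite mul_mx2 mx2_1; congr mx2; ring.
have us : mx2 0 1 1 0 \in @unitmx F 2.
  by rewrite unitmx2 det_mx2 !mx2E mul0r mul1r sub0r oppr_eq0 oner_neq0.
rewrite -[g]mulmx1 -sK mulmxA; apply: (PM) => //; apply: main.
  by rewrite unitmx_mul ug.
rewrite (mx2_eta g) mul_mx2 !mx2E d0 mulr1 mulr0 addr0.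
by move: ug; rewrite unitmx2 det_mx2 d0 mulr0 sub0r oppr_eq0 mulf_eq0 => /norP[].
Qed.

End ScaledIntegral.

(** * The ring C and the group GL_2(C) *)

Section IntegralOutside.
Variables (k K : fieldType) (iota : {rmorphism k -> K}) (infty : place iota).

Lemma integral_outside_const a : integral_outside infty (iota a).
Proof. by move=> P _; right; rewrite (pval_const P). Qed.

Lemma integral_outsideB u v : integral_outside infty u ->
  integral_outside infty v -> integral_outside infty (u - v).
Proof. by move=> Cu Cv P PN; apply: (val_geB (pval_valuation P)); [apply: Cu|apply: Cv]. Qed.

Lemma integral_outsideN u : integral_outside infty u -> integral_outside infty (- u).
Proof. by move=> Cu P PN; apply: (val_geN (pval_valuation P)); apply: Cu. Qed.

Lemma integral_outsideD u v : integral_outside infty u ->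
  integral_outside infty v -> integral_outside infty (u + v).
Proof. by move=> Cu Cv P PN; apply: (val_geD (pval_valuation P)); [apply: Cu|apply: Cv]. Qed.

Lemma integral_outsideM u v : integral_outside infty u ->
  integral_outside infty v -> integral_outside infty (u * v).
Proof.
by move=> Cu Cv P PN; apply: (@val_geM _ _ (pval_valuation P) 0 0) => //; [apply: Cu|apply: Cv].
Qed.

Lemma integral_outsideX u n : integral_outside infty u -> integral_outside infty (u ^+ n).
Proof.
move=> Cu; elim: n => [|n IHn]; last by rewrite exprS; apply: integral_outsideM.
by rewrite expr0 -(rmorph1 iota); apply: integral_outside_const.
Qed.

Local Notation G := (GL2 (integral_outside infty)).

(** The determinant is a nonzero constant, so the adjugate formula keeps the inverse in C. *)
Lemma GL2_mx2 a b c d (u : k) : u != 0 -> a * d - b * c = iota u ->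
  integral_outside infty a -> integral_outside infty b ->
  integral_outside infty c -> integral_outside infty d -> G (mx2 a b c d).
Proof.
move=> u0 D Ca Cb Cc Cd.
have D0 : iota u != 0 by rewrite fmorph_eq0.
have um : mx2 a b c d \in unitmx by rewrite unitmx2 det_mx2 !mx2E D.
have CV : integral_outside infty (iota u)^-1.
  by rewrite -fmorphV; apply: integral_outside_const.
split=> //; first by apply: ord2P; apply: ord2P; rewrite mx2E.
rewrite invmx2 // det_mx2 !mx2E D.
by apply: ord2P; apply: ord2P; rewrite mx2E; apply: integral_outsideM => //;
  apply: integral_outsideN.
Qed.

Lemma GL2_1 : G 1%:M.
Proof.
have C0 := integral_outside_const 0; rewrite rmorph0 in C0.
have C1 := integral_outside_const 1; rewrite rmorph1 in C1.
by rewrite mx2_1; apply: (@GL2_mx2 _ _ _ _ 1); rewrite ?oner_neq0 // rmorph1; ring.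
Qed.

Lemma GL2_inv g : G g -> G (invmx g).
Proof. by case=> ug Cg Cg'; split; rewrite ?unitmx_inv ?invmxK. Qed.

Lemma GL2_mul g h : G g -> G h -> G (g *m h).
Proof.
have Cmul (A B : 'M[K]_2) i l : (forall i j, integral_outside infty (A i j)) ->
    (forall i j, integral_outside infty (B i j)) -> integral_outside infty ((A *m B) i l).
  move=> CA CB; rewrite mxE !big_ord_recl big_ord0 addr0.
  by apply: integral_outsideD; apply: integral_outsideM.
case=> ug Cg Cg' [uh Ch Ch']; split; first by rewrite unitmx_mul ug.
  by move=> i l; apply: Cmul.
have -> : invmx (g *m h) = invmx h *m invmx g.
  have ugh : g *m h \in unitmx by rewrite unitmx_mul ug.
  by apply: (can_inj (mulKmx ugh)); rewrite mulmxV // -mulmxA mulKVmx // mulmxV.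
by move=> i l; apply: Cmul.
Qed.

End IntegralOutside.

(** * The coordinate ring of the conic and the residue field at infinity *)

Section ConicRing.
Variables (k K : fieldType) (iota : {rmorphism k -> K}) (infty : place iota).
Variables (x y : K) (e d rho sigma : k).
Hypotheses (nu_x : infty x = -1) (nu_y : infty y = -1).
Hypothesis CE : integral_outside infty = poly_ring_in iota x y.
Hypothesis xyE : y ^+ 2 + iota e * (x * y) + iota rho * x ^+ 2 + iota d * x + iota sigma = 0.
Hypothesis quadratic_noroot : forall c : k, c ^+ 2 + e * c + rho != 0.

Let nuP := pval_valuation infty.
Let t := y / x.
Local Notation ev f := (map_poly iota f).[x].

Lemma gen_x_neq0 : x != 0.
Proof. by apply/eqP => x0; move: nu_x; rewrite x0 (dval0 nuP). Qed.

Lemma gen_y_neq0 : y != 0.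
Proof. by apply/eqP => y0; move: nu_y; rewrite y0 (dval0 nuP). Qed.

Lemma gen_x_integral : integral_outside infty x.
Proof.
rewrite CE; exists 'X.
by rewrite map_polyX hornerX hornerC.
Qed.

Lemma gen_y_integral : integral_outside infty y.
Proof.
rewrite CE; exists ('X)%:P.
by rewrite map_polyC /= map_polyX hornerC hornerX.
Qed.

Lemma val_ge_const a : val_ge infty 0 (iota a).
Proof. by right; rewrite (pval_const infty). Qed.

(** Dividing the conic equation by x^2 shows that the residue of [t] is a root of c^2 + e c + rho. A
    relation with b != 0 would put this root, - a / b, in k. *)
Lemma residue_free a b : val_ge infty 1 (iota a + iota b * t) -> a = 0 /\ b = 0.
Proof.
have x0 := gen_x_neq0; have y0 := gen_y_neq0.
have const1 c : val_ge infty 1 (iota c) -> c = 0.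
  move=> h; apply/eqP; apply: contraT => c0.
  have := val_geP _ h; rewrite (pval_const infty) fmorph_eq0 => /(_ c0).
  by lia.
have vt : val_ge infty 0 t.
  by right; rewrite dvalM ?invr_neq0 // (dvalV nuP) nu_x nu_y.
have [->|b0] := eqVneq b 0.
  by rewrite rmorph0 mul0r addr0 => /const1.
move=> h; exfalso; pose c := - a / b.
have tc : val_ge infty 1 (t - iota c).
  have -> : t - iota c = (iota a + iota b * t) * iota b^-1.
    by rewrite /c !fmorphV rmorphM rmorphN fmorphV; field; rewrite fmorph_eq0.
  by apply: (@val_geM _ _ nuP 1 0) => //; apply: val_ge_const.
have tE : t ^+ 2 + iota e * t + iota rho = - ((iota d * x + iota sigma) * x ^- 2).
  have -> : iota d * x + iota sigma = - (y ^+ 2 + iota e * (x * y) + iota rho * x ^+ 2).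
    by rewrite -[LHS]subr0 -xyE; ring.
  by rewrite /t; field.
suff /const1 : val_ge infty 1 (iota (c ^+ 2 + e * c + rho)).
  by apply/eqP.
have -> : iota (c ^+ 2 + e * c + rho) =
    (t ^+ 2 + iota e * t + iota rho) - (t - iota c) * (t + iota c + iota e).
  by rewrite !rmorphD rmorphM rmorphXn; ring.
apply: val_geB => //.
  rewrite tE; apply: val_geN => //; apply: (@val_geM _ _ nuP (-1) 2) => //.
    apply: val_geD => //; last by apply: val_geW (val_ge_const _).
    by apply: (@val_geM _ _ nuP 0 (-1)); [|exact: val_ge_const|right; rewrite nu_x].
  by right; rewrite dvalV // dvalX // nu_x.
apply: (@val_geM _ _ nuP 1 0) => //; apply: val_geD (val_ge_const _) => //;
exact: val_geD (val_ge_const _).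
Qed.

(** Multiplication by x and by y preserves k[x] + y k[x], the latter because the conic equation
    rewrites y^2. *)
Lemma conic_ring_normal_form z : integral_outside infty z ->
  exists f g : {poly k}, z = ev f + y * ev g.
Proof.
have mulx f g : exists f' g' : {poly k}, (ev f + y * ev g) * x = ev f' + y * ev g'.
  by exists (f * 'X), (g * 'X); rewrite !rmorphM /= map_polyX !hornerMX; ring.
have muly f g : exists f' g' : {poly k}, (ev f + y * ev g) * y = ev f' + y * ev g'.
  exists (- (rho *: 'X^2 + d *: 'X + sigma%:P) * g), (f - e *: 'X * g).
  rewrite rmorphB !rmorphM rmorphN !rmorphD /= !map_polyZ /= map_polyX map_polyXn map_polyC.
  rewrite !(hornerD, hornerN, hornerM, hornerZ, hornerX, hornerXn, hornerC).
  have -> : (ev f + y * ev g) * y = y * ev f + ev g * y ^+ 2 by ring.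
  have -> : y ^+ 2 = - (iota e * (x * y) + iota rho * x ^+ 2 + iota d * x + iota sigma).
    by rewrite -[LHS]subr0 -xyE; ring.
  by ring.
have addc f g f' g' : exists f'' g'' : {poly k},
    (ev f + y * ev g) + (ev f' + y * ev g') = ev f'' + y * ev g''.
  by exists (f + f'), (g + g'); rewrite !rmorphD /= !hornerD; ring.
(* In [poly_ring_in] the outer variable is evaluated at x and the coefficients at y, hence two
   inductions: this one for a coefficient, then one for the outer polynomial. *)
have eval_y (p : {poly k}) : exists f g : {poly k}, (map_poly iota p).[y] = ev f + y * ev g.
  elim/poly_ind: p => [|p c [f [g E]]].
    by exists 0, 0; rewrite rmorph0 !horner0; ring.
  rewrite rmorphD rmorphM /= map_polyX map_polyC hornerMXaddC E.
  have [f' [g' ->]] := muly f g.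
  rewrite [X in _ + X](_ : _ = ev c%:P + y * ev 0); last first.
    by rewrite map_polyC hornerC rmorph0 horner0 mulr0 addr0.
  exact: addc.
rewrite CE => -[p ->]; elim/poly_ind: p => [|p c [f [g E]]].
  by exists 0, 0; rewrite !rmorph0 !horner0; ring.
rewrite rmorphD rmorphM /= map_polyX map_polyC hornerMXaddC hornerD hornerM hornerC E.
have [f' [g' ->]] := mulx f g; have [f'' [g'' ->]] := eval_y c.
exact: addc.
Qed.

(** In the normal form, x^(i+1) and y x^i have the same pole order, and by [residue_free] their
    leading parts cannot cancel. So the top coefficients vanish and the degrees descend until only a
    constant is left. *)
Lemma integral_outside_val_ge0 z : integral_outside infty z -> val_ge infty 0 z ->
  exists a, z = iota a.
Proof.
have x0 := gen_x_neq0.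
move=> /conic_ring_normal_form[f [g ->]].
(* The successor on the size of [g] accounts for the pole of the factor y. *)
have [n] := ubnP (maxn (size f) (size g).+1); rewrite gtn_max.
elim: n => [//|n IHn] /andP[sf sg].
have evE m (p : {poly k}) : (size p <= m)%N -> ev p = \sum_(i < m) iota p`_i * x ^+ i.
  move=> sp; rewrite (@horner_coef_wide _ m) ?size_map_poly //.
  by apply: eq_bigr => i _; rewrite coef_map.
have sumv m (p : {poly k}) : val_ge infty (1 - m%:Z) (\sum_(i < m) iota p`_i * x ^+ i).
  apply: val_ge_sum => // i; apply: (@val_geM _ _ nuP 0 (- i%:Z)); last first.
  - by right; rewrite dvalX // nu_x; lia.
  - exact: val_ge_const.
  - by have := ltn_ord i; lia.
case: n IHn sf sg => [|n] IHn sf sg; first by lia.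
case: n IHn sf sg => [|n] IHn sf sg.
  have -> : g = 0 by apply/eqP; rewrite -size_poly_eq0; lia.
  rewrite rmorph0 horner0 mulr0 addr0 => _.
  by rewrite [f]size1_polyC ?map_polyC ?hornerC; [exists f`_0|lia].
move=> vz; apply: IHn (vz).
have fE := evE n.+2 f sf; have gE := evE n.+1 g sg.
move: fE gE; rewrite big_ord_recr [in X in _ -> X -> _]big_ord_recr /= => fE gE.
set a := f`_n.+1 in fE; set b := g`_n in gE.
(* [z] and all lower terms have poles of order at most n, so division by x^(n+1) puts a + b t in the
   maximal ideal. *)
have [a0 b0] : a = 0 /\ b = 0.
  apply: residue_free.
  have -> : iota a + iota b * t = ((ev f + y * ev g) - \sum_(i < n.+1) iota f`_i * x ^+ i
        - y * \sum_(i < n) iota g`_i * x ^+ i) * x ^- n.+1.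
    by rewrite fE gE /t !exprS; field; rewrite x0 expf_neq0.
  apply: (@val_geM _ _ nuP (- n%:Z) n.+1) => //; first by lia.
    apply: val_geB => //; first apply: val_geB => //.
    - by apply: val_geW vz; lia.
    - by apply: val_geW (sumv _ _); lia.
    - apply: (@val_geM _ _ nuP (-1) (1 - n%:Z)) => //; first by lia.
      by right; rewrite nu_y.
  by right; rewrite dvalV // dvalX // nu_x; lia.
rewrite !ltnS; apply/andP; split; apply/leq_sizeP => i.
  rewrite leq_eqVlt => /orP[/eqP<- //|ni]; apply/(leq_sizeP _ _ sf); lia.
rewrite leq_eqVlt => /orP[/eqP<- //|ni]; apply/(leq_sizeP _ _ sg); lia.
Qed.

Lemma integral_outside_val_ge1 z : integral_outside infty z -> val_ge infty 1 z -> z = 0.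
Proof.
move=> Cz vz; have [a za] := integral_outside_val_ge0 Cz (val_geW ler01 vz).
move: vz; rewrite za -[iota a]addr0 -(mul0r t) -(rmorph0 iota) => /residue_free[-> _].
by rewrite !rmorph0 mul0r addr0.
Qed.

Lemma integral_outside_const_mod a b : integral_outside infty a -> integral_outside infty b ->
  val_ge infty 0 a -> val_ge infty 0 b -> val_ge infty 1 (a + b * t) -> a = 0 /\ b = 0.
Proof.
move=> Ca Cb va vb.
have [a' ->] := integral_outside_val_ge0 Ca va.
have [b' ->] := integral_outside_val_ge0 Cb vb.
by move=> /residue_free[-> ->]; rewrite rmorph0.
Qed.

(** The determinant and its inverse are nonzero elements of C, and these have value at most 0. *)
Lemma GL2_det_val g : GL2 (integral_outside infty) g -> infty (\det g) = 0.
Proof.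
case=> ug Cg Cg'.
have Cdet (N : 'M[K]_2) : (forall i l, integral_outside infty (N i l)) ->
    integral_outside infty (\det N).
  by move=> CN; rewrite det_mx2; apply: integral_outsideB; apply: integral_outsideM.
have le0 z : z != 0 -> integral_outside infty z -> infty z <= 0.
  move=> z0 Cz; rewrite leNgt; apply/negP => zpos.
  by move: z0; rewrite (integral_outside_val_ge1 Cz) ?eqxx //; right; lia.
rewrite unitmx2 in ug.
have := le0 _ ug (Cdet _ Cg); have := le0 _ (invr_neq0 ug).
rewrite -det_inv => /(_ (Cdet _ Cg')); rewrite det_inv dvalV //.
by move: (infty _) => n; lia.
Qed.

Hypothesis deg_infty : place_degree infty = 2%N.

(** The residue field has dimension 2 over k, and 1 and [t] are independent in it, hence a basis. *)
Lemma residue_span z : val_ge infty 0 z ->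
  exists a b, val_ge infty 1 (z - (iota a + iota b * t)).
Proof.
(* A degree equal to 2 excludes the dummy dimension 0, so an actual basis exists. *)
have : has_quot_dim iota (val_ring infty) (val_ideal infty) 2.
  move: deg_infty; rewrite /place_degree /quot_dim; case: xgetP => [n -> Pn n2|//].
  by rewrite -n2.
case=> b [vb bP] vz.
have x0 := gen_x_neq0; have y0 := gen_y_neq0.
have vt : val_ge infty 0 t.
  by right; rewrite dvalM ?invr_neq0 // (dvalV nuP) nu_x nu_y.
have v1 : val_ge infty 0 1 by right; rewrite (dval1 nuP).
have coord u : val_ge infty 0 u -> exists c : 'rV[k]_2,
    val_ge infty 1 (u - (iota (c 0 0) * b 0 + iota (c 0 1) * b 1)).
  move=> /bP[c [h _]]; exists c; move: h.
  rewrite !big_ord_recl big_ord0 addr0 /val_ideal.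
  by congr (val_ge _ _ (_ - (_ + iota (c 0 _) * b _))); apply: val_inj.
have [c1 h1] := coord _ v1; have [ct ht] := coord _ vt; have [cz hz] := coord _ vz.
pose D := c1 0 0 * ct 0 1 - c1 0 1 * ct 0 0.
have constM a u : val_ge infty 1 u -> val_ge infty 1 (iota a * u).
  by move=> vu; apply: (@val_geM _ _ nuP 0 1) => //; exact: val_ge_const.
(* [D] is the determinant of the coordinates of 1 and [t]. If it vanished, eliminating each basis
   vector in turn would give relations between 1 and [t] forcing the coordinates of 1 to be 0. *)
have D0 : D != 0.
  apply/eqP => D0.
  have [ct1 c11] : - ct 0 1 = 0 /\ c1 0 1 = 0.
    apply: residue_free.
    have -> : iota (- ct 0 1) + iota (c1 0 1) * t =
       iota (- ct 0 1) * (1 - (iota (c1 0 0) * b 0 + iota (c1 0 1) * b 1)) +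
       iota (c1 0 1) * (t - (iota (ct 0 0) * b 0 + iota (ct 0 1) * b 1)) - iota D * b 0.
      by rewrite /D rmorphB !rmorphM !rmorphN; ring.
    rewrite D0 rmorph0 mul0r subr0.
    by apply: val_geD => //; apply: constM.
  have [ct0 c10] : - ct 0 0 = 0 /\ c1 0 0 = 0.
    apply: residue_free.
    have -> : iota (- ct 0 0) + iota (c1 0 0) * t =
       iota (- ct 0 0) * (1 - (iota (c1 0 0) * b 0 + iota (c1 0 1) * b 1)) +
       iota (c1 0 0) * (t - (iota (ct 0 0) * b 0 + iota (ct 0 1) * b 1)) + iota D * b 1.
      by rewrite /D rmorphB !rmorphM !rmorphN; ring.
    rewrite D0 rmorph0 mul0r addr0.
    by apply: val_geD => //; apply: constM.
  move: h1; rewrite c10 c11 rmorph0 !mul0r addr0 subr0.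
  have := @residue_free 1 0; rewrite rmorph1 rmorph0 mul0r addr0 => h /h[/eqP].
  by rewrite oner_eq0.
(* Cramer's rule for the coordinates of [z] in terms of those of 1 and [t]. *)
exists ((cz 0 0 * ct 0 1 - cz 0 1 * ct 0 0) / D), ((c1 0 0 * cz 0 1 - c1 0 1 * cz 0 0) / D).
set a' := _ / D; set b' := _ / D.
have E0 : cz 0 0 = a' * c1 0 0 + b' * ct 0 0.
  by rewrite /a' /b'; move: D0; rewrite /D => D0; field.
have E1 : cz 0 1 = a' * c1 0 1 + b' * ct 0 1.
  by rewrite /a' /b'; move: D0; rewrite /D => D0; field.
have -> : z - (iota a' + iota b' * t) =
   (z - (iota (cz 0 0) * b 0 + iota (cz 0 1) * b 1))
   - iota a' * (1 - (iota (c1 0 0) * b 0 + iota (c1 0 1) * b 1))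
   - iota b' * (t - (iota (ct 0 0) * b 0 + iota (ct 0 1) * b 1)).
  by rewrite E0 E1 !rmorphD !rmorphM; ring.
by apply: val_geB => //; [apply: val_geB => //|]; apply: constM.
Qed.

End ConicRing.

(** All shapes merge into one equation: [e] is 1 for [ConicMixed] and 0 otherwise, [d] is 1 for
    [ConicLin] and 0 otherwise. *)
Lemma conic_generatorsP (k K : fieldType) (iota : {rmorphism k -> K})
    (infty : place iota) (x y : K) : conic_generators infty x y ->
  [/\ infty x = -1, infty y = -1, integral_outside infty = poly_ring_in iota x y &
  exists e d rho sigma : k,
   [/\ y ^+ 2 + iota e * (x * y) + iota rho * x ^+ 2 + iota d * x + iota sigma = 0,
       forall c : k, c ^+ 2 + e * c + rho != 0 &
       forall a b : k, b ^+ 2 + e * (a * b) + rho * a ^+ 2 + d * a + sigma != 0]].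
Proof.
case=> nx ny CE [s [rho [sigma [_ _ sP xyE nsol]]]]; split=> //.
have nosquare c : (~ exists a : k, - rho = a ^+ 2) -> c ^+ 2 + 0 * c + rho != 0.
  move=> h; apply/eqP => E; apply: h; exists c.
  by rewrite -[LHS]addr0 -E; ring.
case: s sP xyE nsol => /= [h|[_ h]|[ch2 h]] xyE nsol.
- exists 0, 0, rho, sigma; split; first by rewrite -[RHS]xyE rmorph0; ring.
    by move=> c; exact: nosquare.
  by move=> a b; apply/eqP => E; apply: nsol; exists a, b; rewrite -E; ring.
- exists 0, 1, rho, sigma; split; first by rewrite -[RHS]xyE rmorph0 rmorph1; ring.
    by move=> c; exact: nosquare.
  by move=> a b; apply/eqP => E; apply: nsol; exists a, b; rewrite -E; ring.
- exists 1, 0, rho, sigma; split; first by rewrite -[RHS]xyE rmorph0 rmorph1; ring.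
    move=> c; apply/eqP => E; apply: h; exists c.
    (* In characteristic 2, rho = - rho, so a root [c] would give rho = c^2 + c. *)
    rewrite -[rho](oppr_pchar2 ch2) -[LHS]addr0 -E; ring.
  by move=> a b; apply/eqP => E; apply: nsol; exists a, b; rewrite -E; ring.
Qed.

(** * The action of GL_2(C) on cosets, and its orbits *)

Section Orbits.
Variables (k K : fieldType) (iota : {rmorphism k -> K}) (infty : place iota).
Variables (Kinf : fieldType) (j : {rmorphism K -> Kinf}).
Local Notation G := (GL2 (integral_outside infty)).
Local Notation act := (tree_act j).

Lemma tree_act_coset (nuinf : Kinf -> int) g M :
  act g (coset_mx nuinf M) = coset_mx nuinf (map_mx j g *m M).
Proof.
apply/seteqP; split=> [_ [_ [h hU <-] <-]|_ [h hU <-]].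
  by exists h => //; rewrite mulmxA.
by exists (M *m h); [exists h|rewrite mulmxA].
Qed.

Lemma tree_act1 v : act 1%:M v = v.
Proof.
rewrite /tree_act map_mx1; apply/seteqP; split=> [_ [a va <-]|a va]; rewrite ?mul1mx //.
by exists a; rewrite ?mul1mx.
Qed.

Lemma tree_actM g h v : act (g *m h) v = act g (act h v).
Proof.
apply/seteqP; split=> [_ [a va <-]|_ [_ [a va <-] <-]].
  by exists (map_mx j h *m a); [exists a|rewrite mulmxA map_mxM].
by exists a; rewrite ?mulmxA ?map_mxM.
Qed.

Lemma tree_actK g v : G g -> act (invmx g) (act g v) = v.
Proof. by case=> ug _ _; rewrite -tree_actM mulVmx // tree_act1. Qed.

Lemma vertex_orbit_eq g v : G g -> vertex_orbit G act (act g v) = vertex_orbit G act v.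
Proof.
move=> Gg; apply/seteqP; split=> _ [h Gh <-].
  by exists (h *m g); [exact: GL2_mul|rewrite tree_actM].
exists (h *m invmx g); first by apply: GL2_mul => //; apply: GL2_inv.
by rewrite tree_actM (tree_actK _ Gg).
Qed.

Lemma edge_orbit_eq g E : G g -> edge_orbit G act (act g @` E) = edge_orbit G act E.
Proof.
have actM (a b : 'M[K]_2) (E' : set (set 'M[Kinf]_2)) : act a @` (act b @` E') = act (a *m b) @` E'.
  by rewrite image_comp; apply: eq_imagel => v _; rewrite /= tree_actM.
move=> Gg; apply/seteqP; split=> _ [h Gh <-].
  by exists (h *m g); [exact: GL2_mul|rewrite actM].
exists (h *m invmx g); first by apply: GL2_mul => //; apply: GL2_inv.
by rewrite actM; case: Gg => ug _ _; rewrite mulmxKV.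
Qed.

Lemma edge_orbit_self E : edge_orbit G act E E.
Proof.
exists 1%:M; first exact: GL2_1.
by rewrite -[RHS]image_id; apply: eq_imagel => v _; rewrite tree_act1.
Qed.

Lemma vertex_orbit_self v : vertex_orbit G act v v.
Proof. by exists 1%:M; [exact: GL2_1|rewrite tree_act1]. Qed.

End Orbits.

(** * Representatives of the path vertices and their inequivalence *)

Section QuotientTree.
Variables (k K : fieldType) (iota : {rmorphism k -> K}) (infty : place iota).
Variables (x y : K) (e d rho sigma : k).
Hypotheses (nu_x : infty x = -1) (nu_y : infty y = -1).
Hypothesis CE : integral_outside infty = poly_ring_in iota x y.
Hypothesis xyE : y ^+ 2 + iota e * (x * y) + iota rho * x ^+ 2 + iota d * x + iota sigma = 0.
Hypothesis quadratic_noroot : forall c : k, c ^+ 2 + e * c + rho != 0.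
Variables (pi : K) (nu_pi : infty pi = 1).
Variables (Kinf : fieldType) (nuinf : Kinf -> int) (j : {rmorphism K -> Kinf}).
Hypothesis Kinf_completion : is_completion infty nuinf j.

Local Notation C := (integral_outside infty).
Local Notation G := (GL2 C).
Local Notation coset := (coset_mx nuinf).
Let t := y / x.
Let nuP := pval_valuation infty.
Let muP := compl_valuation Kinf_completion.
Let x0 := gen_x_neq0 nu_x.
Let y0 := gen_y_neq0 nu_y.

Lemma nuinf_j z : nuinf (j z) = infty z. Proof. exact: compl_extends Kinf_completion z. Qed.

Let mu_pi : nuinf (j pi) = 1. Proof. by rewrite nuinf_j. Qed.
Let pi0 := uniformizer_neq0 nuP nu_pi.
Let jx0 : j x != 0. Proof. by rewrite fmorph_eq0. Qed.
Let jpi0 : j pi != 0. Proof. by rewrite (uniformizer_neq0 muP mu_pi). Qed.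
Let coset_eqP := coset_mx_eqP muP mu_pi.
Let coset_mulr := coset_mx_mulr muP mu_pi.
Let affine_eq := coset_affine_eq muP mu_pi.
Let nu_t : infty t = 0.
Proof. by rewrite dvalM ?invr_neq0 // dvalV // nu_x nu_y. Qed.

Lemma val_ge_j n z : val_ge infty n z -> val_ge nuinf n (j z).
Proof. by case=> [->|nz]; [left; rewrite rmorph0|right; rewrite nuinf_j]. Qed.

Lemma val_ge_jV n z : val_ge nuinf n (j z) -> val_ge infty n z.
Proof.
have [->|z0] := eqVneq z 0; first by left.
by move=> /val_geP h; right; rewrite -nuinf_j; apply: h; rewrite fmorph_eq0.
Qed.

(** Indices are shifted by one: 0 stands for v_* and m + 1 for v_m. *)
Definition path_rep (n : nat) : 'M[Kinf]_2 :=
  if n is m.+1 then affine_mx (j pi ^ (- m%:Z)) 0 else affine_mx (j pi) (j t).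

Lemma standard_pathE n : standard_path pi nuinf j t n = coset (path_rep n).
Proof. by case: n. Qed.

Lemma path_rep_unit n : path_rep n \in unitmx.
Proof. by case: n => [|n]; rewrite affine_mx_unit ?expfz_neq0. Qed.

Lemma path_rep1 : path_rep 1 = 1%:M.
Proof. by rewrite /= oppr0 expr0z affine_mxE mx2_1. Qed.

(** Comparing determinants gives 2l = m - n > 0, where l bounds from below the values of the entries
    of [h]. As [path_rep m] has second row (0, 1), the second row of the left side is that of [h];
    its smallness forces the second row of [g] to vanish. *)
Lemma path_rep_inequivalent n m g h : (n < m)%N -> G g -> scaled_int nuinf 0 h ->
  map_mx j g *m path_rep n <> path_rep m *m h.
Proof.
case: m => // m; rewrite ltnS => nm Gg [uh [l [dh vh]]] E.
have dg := GL2_det_val nu_x nu_y CE xyE quadratic_noroot Gg.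
have dg0 : \det g != 0 by case: Gg; rewrite unitmx2.
have Cg : forall i l, C (g i l) by case: Gg.
have [/= g10 g11] : g 1 0 = 0 /\ g 1 1 = 0; last first.
  by move: dg0; rewrite det_mx2 g10 g11 !mulr0 subrr eqxx.
have dE : infty (\det g) + nuinf (\det (path_rep n)) =
    nuinf (\det (path_rep m.+1)) + (l + l).
  have uP i : \det (path_rep i) != 0 by rewrite -unitmx2 path_rep_unit.
  rewrite unitmx2 in uh.
  rewrite addr0 in dh; rewrite -dh -nuinf_j -!dvalM ?fmorph_eq0 //.
  by rewrite -det_map_mx -!det_mulmx E.
have det_rep i : nuinf (\det (path_rep i)) = 1 - i%:Z.
  case: i => [|i]; rewrite det_mx2 /= affine_mxE !mx2E mulr0 subr0 mulr1 ?mu_pi //.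
  by rewrite dvalXz // mu_pi; lia.
rewrite !det_rep dg add0r in dE.
have row1 : (map_mx j g *m path_rep n) 1 = h 1.
  rewrite E; apply/funext => i; rewrite /= affine_mxE (mx2_eta h) mul_mx2.
  by move: i; apply: ord2P; rewrite !mx2E; ring.
have {}vh i : val_ge nuinf l ((map_mx j g *m path_rep n) 1 i) by rewrite row1; exact: vh.
rewrite (mx2_eta g) map_mx2 in vh.
(* From v_* the first column only shows that g_10 has no pole, and the freeness of 1 and [t]
   concludes. From the other vertices both entries are in C and have positive value. *)
case: n nm dE vh {E row1} => [|n] nm dE vh.
  move: (vh 0) (vh 1); rewrite /= affine_mxE mul_mx2 !mx2E mulr0 addr0 mulr1.
  rewrite -!rmorphM -rmorphD => /val_ge_jV v0 /val_ge_jV v1.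
  have v10 : val_ge infty 0 (g 1 0).
    rewrite -[g 1 0](mulfK (x := pi)) ?(uniformizer_neq0 nuP nu_pi) //.
    apply: (@val_geM _ _ nuP l (-1)) => //; first by lia.
    by right; rewrite dvalV // nu_pi.
  have vt : val_ge infty 0 (g 1 0 * t).
    by apply: (@val_geM _ _ nuP 0 0) => //; right; rewrite nu_t.
  have v11 : val_ge infty 0 (g 1 1).
    rewrite -[g 1 1](addKr (g 1 0 * t)) addrC; apply: val_geB => //.
    by apply: val_geW v1; lia.
  have [] := integral_outside_const_mod nu_x nu_y CE xyE quadratic_noroot
    (Cg 1 1) (Cg 1 0) v11 v10 _; last by move=> -> ->.
  by rewrite addrC; apply: val_geW v1; lia.
have small := integral_outside_val_ge1 nu_x nu_y CE xyE quadratic_noroot.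
move: (vh 0) (vh 1); rewrite /= affine_mxE mul_mx2 !mx2E !mulr0 addr0 mulr1 add0r.
move=> v0 /val_ge_jV v1; split; apply: small => //; last by apply: val_geW v1; lia.
apply: val_ge_jV.
rewrite -[j (g 1 0)](mulfK (x := j pi ^ (- n%:Z))) ?expfz_neq0 //.
apply: (@val_geM _ _ muP l n) => //; first by lia.
by right; rewrite dvalV // dvalXz // mu_pi; lia.
Qed.

Lemma path_rep_inj n m g : G g -> tree_act j g (coset (path_rep n)) = coset (path_rep m) ->
  n = m.
Proof.
move=> Gg E; case: (ltngtP n m) => // nm; exfalso.
  move: E; rewrite tree_act_coset => /coset_eqP[h sh].
  exact: path_rep_inequivalent.
(* For m < n the inverse of [g] exchanges the two roles. *)
have := tree_actK j (coset (path_rep n)) Gg; rewrite E tree_act_coset => /coset_eqP[h sh].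
by apply: path_rep_inequivalent => //; apply: GL2_inv.
Qed.

Lemma standard_path_inj : injective (standard_path pi nuinf j t).
Proof.
move=> n m; rewrite !standard_pathE => E.
by apply: (path_rep_inj (GL2_1 infty)); rewrite tree_act1.
Qed.

(** The matrix with determinant pi is scaled with n = 0, the one with determinant pi^-1 with n =
    -1. *)
Lemma adjacent_scaled_int g1 g2 :
  adjacent_mx infty pi nuinf j g1 g2 -> scaled_int nuinf 1 (invmx g2 *m g1).
Proof.
case=> [[z [vz /(coset_mxP muP mu_pi)[h sh ->]]]|/(coset_mxP muP mu_pi)[h sh ->]];
  rewrite -(addr0 1); apply: (scaled_intM muP) => //; rewrite affine_mxE.
  apply: (@scaled_intP _ _ _ 0); rewrite ?mulr0 ?subr0 ?mulr1 ?mu_pi //.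
  - by right; rewrite mu_pi.
  - exact: val_ge_j.
  - exact: val_ge0.
  - by right; rewrite (dval1 muP).
apply: (@scaled_intP _ _ _ (-1)); rewrite ?mulr0 ?subr0 ?mulr1 ?invr_neq0 ?dvalV ?mu_pi //;
  try exact: val_ge0.
- by right; rewrite dvalV // mu_pi.
- by right; rewrite (dval1 muP).
Qed.

(** * Neighbours of the path vertices modulo GL_2(C) *)

Hypothesis deg_infty : place_degree infty = 2%N.

(** By density, an element of the completion agrees modulo the maximal ideal with one of K. *)
Lemma residue_span_completion z : val_ge nuinf 0 z ->
  exists a b, val_ge nuinf 1 (z - j (iota a + iota b * t)).
Proof.
move=> vz; have [w vw] := compl_dense Kinf_completion z 1.
have /val_ge_jV : val_ge nuinf 0 (j w).
  rewrite -(subKr z (j w)); apply: val_geB => //.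
  by apply: val_geW vw.
move=> /(residue_span nu_x nu_y xyE quadratic_noroot deg_infty)[a [b vab]].
exists a, b; rewrite -[z](subrK (j w)) -addrA -rmorphB.
by apply: val_geD => //; apply: val_ge_j.
Qed.

(** Unordered pairs leave open which endpoint comes first along the path. *)
Definition path_edge (u v : set 'M[Kinf]_2) :=
  exists n, [set u; v] = [set coset (path_rep n); coset (path_rep n.+1)].

Lemma path_edgeC u v : path_edge u v -> path_edge v u.
Proof. by case=> n E; exists n; rewrite setUC. Qed.

(** This is the inclusion of GL_2(k) in the stabilizer of v_0. *)
Lemma constant_mx a b c f : a * f - b * c != 0 ->
  let g := mx2 (iota a) (iota b) (iota c) (iota f) in
  G g /\ scaled_int nuinf 0 (map_mx j g).
Proof.
move=> D0 g; have DE : iota a * iota f - iota b * iota c = iota (a * f - b * c).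
  by rewrite rmorphB !rmorphM.
split; first by apply: (GL2_mx2 D0 DE); apply: integral_outside_const.
have vc z : val_ge nuinf 0 (j (iota z)) by apply: val_ge_j; apply: val_ge_const.
rewrite map_mx2; apply: (@scaled_intP _ _ _ 0) => //; rewrite -!rmorphM -!rmorphB /=.
  by rewrite !fmorph_eq0.
by rewrite nuinf_j (pval_const infty).
Qed.

Lemma neighbor_v0 M : scaled_int nuinf 1 M ->
  exists2 g, G g & path_edge (coset (map_mx j g)) (coset (map_mx j g *m M)).
Proof.
case/(scaled_int1_affine muP mu_pi) => [[h sh ->]|[z [vz [h sh ->]]]].
  exists 1%:M; first exact: GL2_1.
  exists 1%N; rewrite path_rep1 map_mx1 mul1mx coset_mulr //.
have cosetU (N : 'M[Kinf]_2) : scaled_int nuinf 0 N -> coset N = coset (path_rep 1).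
  by move=> sN; rewrite path_rep1 -[N]mul1mx coset_mulr.
have [a [b vab]] := residue_span_completion vz.
have [b0|b0] := eqVneq b 0.
  (* A residue [a] in k is sent to infinity by w -> 1 / (w - a), so the neighbour goes to v_1. *)
  have [|Gg sg] := @constant_mx 0 1 1 (- a).
    by rewrite mul0r mul1r sub0r oppr_eq0 oner_neq0.
  exists (mx2 (iota 0) (iota 1) (iota 1) (iota (- a))) => //; exists 1%N.
  rewrite (cosetU _ sg); congr [set _; _].
  rewrite mulmxA coset_mulr //; apply/coset_eqP.
  exists (mx2 0 (j pi) (j pi) (z - j (iota a))); last first.
    rewrite map_mx2 /= affine_mxE (affine_mxE (j pi ^ -1)) !mul_mx2.
    by rewrite !(rmorph0, rmorph1, rmorphN) exprN1; congr mx2; field.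
  have v1 : val_ge nuinf 1 (j pi) by right; rewrite mu_pi.
  apply: (@scaled_intP _ _ _ 1) => //; rewrite ?mul0r ?sub0r ?oppr_eq0 ?mulf_neq0 //.
  - by rewrite dvalN // dvalM // mu_pi.
  - exact: val_ge0.
  - by move: vab; rewrite b0 rmorph0 mul0r addr0.
(* A residue a + b t outside k is sent to [t] by w -> (w - a) / b, so the neighbour goes to v_*. *)
have [|Gg sg] := @constant_mx b^-1 (- a / b) 0 1.
  by rewrite mulr1 mulr0 subr0 invr_neq0.
exists (mx2 (iota b^-1) (iota (- a / b)) (iota 0) (iota 1)) => //.
apply: path_edgeC; exists 0%N; rewrite (cosetU _ sg); congr [set _; _].
rewrite mulmxA coset_mulr // map_mx2 rmorph0 rmorph1 rmorph0 rmorph1.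
rewrite -affine_mxE mul_affine; apply: affine_eq => //.
- by rewrite mulf_neq0 // !fmorph_eq0 invr_neq0.
- by rewrite dvalM ?fmorph_eq0 ?invr_neq0 // mu_pi nuinf_j (pval_const infty).
have jb0 : j (iota b) != 0 by rewrite !fmorph_eq0.
have -> : j (iota b^-1) * z + j (iota (- a / b)) - j t =
    j (iota b^-1) * (z - j (iota a + iota b * t)).
  by rewrite !(rmorphM, rmorphD, rmorphN, fmorphV); field; rewrite jx0 jb0.
rewrite dvalM ?fmorph_eq0 ?invr_neq0 // mu_pi nuinf_j (pval_const infty) add0r.
apply: (@val_geM _ _ muP 0 1) => //.
by right; rewrite nuinf_j (pval_const infty).
Qed.

(** Index [n.+2] is v_(n+1). One neighbour is v_(n+2) itself; a translation fixing v_(n+1) carries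
    any other to v_n. *)
Lemma neighbor_vS n M : scaled_int nuinf 1 M ->
  exists2 g, G g & path_edge (coset (map_mx j g *m path_rep n.+2))
                             (coset (map_mx j g *m path_rep n.+2 *m M)).
Proof.
case/(scaled_int1_affine muP mu_pi) => [[h sh ->]|[z [vz [h sh ->]]]].
  exists 1%:M; first exact: GL2_1.
  exists n.+2; rewrite map_mx1 mul1mx mulmxA coset_mulr //; congr [set _; coset _].
  rewrite /path_rep mul_affine mulr0 addr0 -exprN1 -expfzDr //.
  by congr (affine_mx (_ ^ _) _); lia.
(* This unit converts pi^-(n+1) into x^(n+1), which lies in C. *)
pose u := j pi * j x.
have u0 : u != 0 by rewrite mulf_neq0 // fmorph_eq0.
have nu_u : nuinf u = 0 by rewrite dvalM ?fmorph_eq0 // mu_pi nuinf_j nu_x.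
have [|a [b vab]] := @residue_span_completion (z * u ^- n.+1).
  by apply: (@val_geM _ _ muP 0 0) => //; right; rewrite dvalV // dvalX // nu_u; lia.
(* [c] agrees with pi^-(n+1) z up to value - n, so subtracting it turns the neighbour into v_n. *)
pose c := iota a * x ^+ n.+1 + iota b * (y * x ^+ n).
have cE : c = x ^+ n.+1 * (iota a + iota b * t).
  by rewrite /c /t exprS; field.
have Cx := gen_x_integral CE; have Cy := gen_y_integral CE.
have Cc : C c.
  apply: integral_outsideD; apply: integral_outsideM; try exact: integral_outside_const.
    exact: integral_outsideX.
  by apply: integral_outsideM => //; apply: integral_outsideX.
(* This bound is what makes the translation by - c fix v_(n+1). *)
have vc : val_ge nuinf (- n.+1%:Z) (j c).
  apply: val_ge_j; rewrite cE; apply: (@val_geM _ _ nuP (- n.+1%:Z) 0); first by lia.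
    by right; rewrite dvalX // nu_x; lia.
  apply: val_geD => //; first exact: val_ge_const.
  apply: (@val_geM _ _ nuP 0 0) => //; first exact: val_ge_const.
  by right; rewrite nu_t.
have C0 : C 0 by rewrite -(rmorph0 iota); apply: integral_outside_const.
have C1 : C 1 by rewrite -(rmorph1 iota); apply: integral_outside_const.
exists (mx2 1 (- c) 0 1).
  apply: (@GL2_mx2 _ _ _ _ _ _ _ _ 1); rewrite ?oner_neq0 ?rmorph1 //; first by ring.
  exact: integral_outsideN.
rewrite map_mx2 rmorph1 rmorph0 rmorphN -affine_mxE !mul_affine mulmxA mul_affine.
rewrite coset_mulr //; apply: path_edgeC; exists n.+1; rewrite mul1r mulr0 add0r.
have pn0 i : j pi ^ i != 0 by rewrite expfz_neq0.
have nu_pn i : nuinf (j pi ^ i) = i by rewrite dvalXz // mu_pi mulr1.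
congr [set _; _]; apply: affine_eq; rewrite ?mulf_neq0 // ?dvalM // ?nu_pn ?mu_pi ?subr0 //.
- by lia.
- have -> : j pi ^ (- n.+1%:Z) * z - j c =
      j x ^+ n.+1 * (z * u ^- n.+1 - j (iota a + iota b * t)).
    rewrite cE rmorphM rmorphXn mulrBr; congr (_ - _).
    rewrite /u exprMn -exprnN; field.
    by rewrite !expf_neq0 // fmorph_eq0.
  apply: (@val_geM _ _ muP (- n.+1%:Z) 1) => //.
  by right; rewrite dvalX // nuinf_j nu_x; lia.
- by apply: val_geN.
Qed.

Hypothesis conic_nopoint :
  forall a b : k, b ^+ 2 + e * (a * b) + rho * a ^+ 2 + d * a + sigma != 0.

(* The matrix [g] below comes from solving for the rows (p, q) with [p] in the
   span of 1, x, y such that [p (x y + a x + b y) + q x ^+ 2] has a pole of order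
   at most 1; its determinant is the value of the conic equation at (b, - a), up to sign. *)
Lemma vstar_to_v0 z : val_ge nuinf 0 z ->
  exists2 g, G g & scaled_int nuinf 0 (map_mx j g *m path_rep 0 *m affine_mx (j pi) z).
Proof.
move=> vz; have [|a [b]] := @residue_span_completion (j (x * pi) * z).
  apply: (@val_geM _ _ muP 0 0) => //; right.
  by rewrite nuinf_j dvalM ?(uniformizer_neq0 nuP nu_pi) // nu_x nu_pi.
set eps := _ - _ => veps.
have detE (P Q R S : K) w : j P * (j pi * j pi) * (j R * w + j S) -
    (j P * w + j Q) * (j R * (j pi * j pi)) = j (P * S - Q * R) * (j pi * j pi).
  by rewrite rmorphB !rmorphM; ring.
have zE : j pi * z + j t = j t + (j (iota a + iota b * t) + eps) / j x.
  by rewrite /eps rmorphM; field.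
pose p := x - iota b; pose q := - (y + iota a).
pose r := y - iota a + iota e * iota b.
pose s := iota rho * (x + iota b) + iota d + iota e * y.
have y2 : y ^+ 2 = - (iota e * (x * y) + iota rho * x ^+ 2 + iota d * x + iota sigma).
  by rewrite -[LHS]subr0 -xyE; ring.
have DE : p * s - q * r =
    iota (- ((- a) ^+ 2 + e * (b * - a) + rho * b ^+ 2 + d * b + sigma)).
  rewrite !(rmorphD, rmorphN, rmorphM, rmorphXn) /=.
  have -> : p * s - q * r = y ^+ 2 + iota e * (x * y) + iota rho * x ^+ 2 + iota d * x
     - iota a ^+ 2 + iota e * (iota a * iota b) - iota rho * iota b ^+ 2 - iota d * iota b.
    by rewrite /p /q /r /s; ring.
  by rewrite y2; ring.
have D0 : - ((- a) ^+ 2 + e * (b * - a) + rho * b ^+ 2 + d * b + sigma) != 0.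
  by rewrite oppr_eq0 conic_nopoint.
have Cx := gen_x_integral CE; have Cy := gen_y_integral CE.
have Cc f : C (iota f) by exact: integral_outside_const.
have Clin u v w : C (iota u + iota v * x + iota w * y).
  apply: integral_outsideD; last exact: integral_outsideM.
  by apply: integral_outsideD => //; apply: integral_outsideM.
have vlin u v w : val_ge infty (-1) (iota u + iota v * x + iota w * y).
  have vc f := val_ge_const infty f.
  apply: val_geD => //; first apply: val_geD => //.
  - by apply: val_geW (vc _).
  - by apply: (@val_geM _ _ nuP 0 (-1)) => //; right; rewrite nu_x.
  - by apply: (@val_geM _ _ nuP 0 (-1)) => //; right; rewrite nu_y.
have pE : p = iota (- b) + iota 1 * x + iota 0 * y.
  by rewrite /p !(rmorphN, rmorph0, rmorph1); ring.
have qE : q = iota (- a) + iota 0 * x + iota (- 1) * y.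
  by rewrite /q !(rmorphN, rmorph0, rmorph1); ring.
have rE : r = iota (e * b - a) + iota 0 * x + iota 1 * y.
  by rewrite /r !(rmorphB, rmorphM, rmorph0, rmorph1); ring.
have sE : s = iota (rho * b + d) + iota rho * x + iota e * y.
  by rewrite /s !(rmorphD, rmorphM); ring.
have Gg : G (mx2 p q r s).
  by apply: (GL2_mx2 D0 DE); rewrite ?pE ?qE ?rE ?sE; apply: Clin.
exists (mx2 p q r s) => //.
have vp : val_ge infty (-1) p by rewrite pE.
have vr : val_ge infty (-1) r by rewrite rE.
have vpi u : val_ge infty (-1) u -> val_ge nuinf 1 (j u * (j pi * j pi)).
  move=> vu; apply: (@val_geM _ _ muP (-1) 2); [by []|exact: val_ge_j|].
  by right; rewrite dvalM // mu_pi.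
(* As pi z + t = (x y + a x + b y) / x^2 + eps / x, a numerator with pole of order at most 1 makes
   the entry divisible by pi. *)
have col2 u v w1 w2 w3 : val_ge infty (-1) u ->
    u * (x * y + iota a * x + iota b * y) + v * x ^+ 2 = iota w1 + iota w2 * x + iota w3 * y ->
    val_ge nuinf 1 (j u * (j pi * z + j t) + j v).
  move=> vu E; rewrite zE.
  have -> : j u * (j t + (j (iota a + iota b * t) + eps) / j x) + j v =
      j (u * (x * y + iota a * x + iota b * y) + v * x ^+ 2) / j x ^+ 2 + j u * (eps / j x).
    by rewrite /t !(rmorphD, rmorphM, rmorphXn, fmorphV); field.
  rewrite E; apply: val_geD => //.
    apply: (@val_geM _ _ muP (-1) 2) => //; first exact/val_ge_j/vlin.
    by right; rewrite dvalV // dvalX // nuinf_j nu_x.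
  apply: (@val_geM _ _ muP (-1) 2) => //; first exact: val_ge_j.
  by apply: (@val_geM _ _ muP 1 1) => //; right; rewrite dvalV // nuinf_j nu_x.
rewrite /path_rep -mulmxA mul_affine map_mx2 affine_mxE mul_mx2 !mulr0 !addr0 !mulr1.
(* All entries have value at least 1, and the determinant is a nonzero constant times pi^2. *)
apply: (@scaled_intP _ _ _ 1); rewrite ?detE.
- by rewrite DE !mulf_neq0 // !fmorph_eq0.
- by rewrite DE !dvalM ?mulf_neq0 ?fmorph_eq0 // mu_pi nuinf_j (pval_const infty).
- exact: vpi.
- apply: (col2 _ _ 0 (- (a * b)) (- b ^+ 2)) => //.
  by rewrite /p /q !(rmorphN, rmorphM, rmorphXn, rmorph0); ring.
- exact: vpi.
- apply: (col2 _ _ (- (b * sigma)) (e * (a * b) - a ^+ 2 - b * d - sigma)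
    (e * b ^+ 2 - a * b)) => //.
  rewrite !(rmorphN, rmorphD, rmorphM, rmorphXn) /=.
  have -> : r * (x * y + iota a * x + iota b * y) + s * x ^+ 2 =
    (x + iota b) * (y ^+ 2 + iota e * (x * y) + iota rho * x ^+ 2) + iota d * x ^+ 2
    - iota a ^+ 2 * x - iota a * iota b * y + iota e * iota a * iota b * x
    + iota e * iota b ^+ 2 * y by rewrite /r /s; ring.
  by rewrite y2; ring.
Qed.

(** Either the neighbour is v_0, or [vstar_to_v0] carries it there; the image of v_* is then a
    neighbour of v_0, to which [neighbor_v0] applies. *)
Lemma neighbor_vstar M : scaled_int nuinf 1 M ->
  exists2 g, G g & path_edge (coset (map_mx j g *m path_rep 0))
                             (coset (map_mx j g *m path_rep 0 *m M)).
Proof.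
move=> sM; have uM : M \in unitmx by case: sM.
case: (scaled_int1_affine muP mu_pi sM) => [[h sh ->]|[z [vz [h sh ME]]]].
  exists 1%:M; first exact: GL2_1.
  exists 0%N; rewrite map_mx1 mul1mx mulmxA coset_mulr //; congr [set _; _].
  rewrite /path_rep mul_affine mulr0 add0r oppr0 expr0z divff //.
  apply: affine_eq; rewrite ?oner_neq0 // (dval1 muP) subr0.
  by apply: val_ge_j; right; rewrite nu_t.
have [g Gg sg] := vstar_to_v0 vz.
set g0 := map_mx j g *m path_rep 0 *m _ in sg.
have gM : map_mx j g *m path_rep 0 *m M = g0 *m h by rewrite ME mulmxA.
have sgh : scaled_int nuinf 0 (g0 *m h) by rewrite -(addr0 0); apply: (scaled_intM muP).
have sN : scaled_int nuinf 1 (g0 *m h *m invmx M).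
  rewrite -(add0r 1); apply: (scaled_intM muP) => //; exact: (scaled_intV muP).
have [g' Gg' [n E]] := neighbor_v0 sN.
exists (g' *m g); first exact: GL2_mul.
have gM' : map_mx j (g' *m g) *m path_rep 0 *m M = map_mx j g' *m (g0 *m h).
  by rewrite map_mxM -gM !mulmxA.
have g0E : map_mx j (g' *m g) *m path_rep 0 = map_mx j g' *m (g0 *m h *m invmx M).
  by rewrite map_mxM -gM mulmxK // mulmxA.
by exists n; rewrite -E setUC gM' g0E coset_mulr.
Qed.

Lemma path_neighbor n M : scaled_int nuinf 1 M ->
  exists2 g, G g & path_edge (coset (map_mx j g *m path_rep n))
                             (coset (map_mx j g *m path_rep n *m M)).
Proof.
case: n => [|[|n]]; [exact: neighbor_vstar| |exact: neighbor_vS].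
by move=> /neighbor_v0[g Gg E]; exists g; rewrite // path_rep1 mulmx1.
Qed.

Lemma path_edge_fst u v : path_edge u v -> exists n, u = coset (path_rep n).
Proof.
case=> n E; have : [set u; v] u by left.
by rewrite E => -[->|->]; [exists n|exists n.+1].
Qed.

(** Starting from v_0, the right factors that preserve reachability of the path are closed under
    products. They contain [scaled_int 0], which fixes the coset, and [scaled_int 1] by
    [path_neighbor], hence everything by [unitmx_generated]. *)
Lemma vertex_orbit_rep g : g \in unitmx ->
  exists2 c, G c & exists n, coset (map_mx j c *m g) = coset (path_rep n).
Proof.
pose reach (M : 'M[Kinf]_2) :=
  exists2 c, G c & exists n, coset (map_mx j c *m M) = coset (path_rep n).
pose P := [set N | forall M, reach M -> reach (M *m N)].
move=> ug; suff /(_ 1%:M) : P g.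
  rewrite mul1mx; apply; exists 1%:M; first exact: GL2_1.
  by exists 1%N; rewrite path_rep1 map_mx1 mul1mx.
apply: (unitmx_generated muP mu_pi) ug.
- by move=> A B PA PB M /PA/PB; rewrite mulmxA.
- by move=> A sA M [c Gc [n E]]; exists c => //; exists n; rewrite mulmxA coset_mulr.
move=> A sA M [c Gc [n /coset_eqP[h sh E]]].
have sN : scaled_int nuinf 1 (h *m A) by rewrite -(add0r 1); apply: (scaled_intM muP).
have [c' Gc' /path_edgeC/path_edge_fst[m E']] := path_neighbor n sN.
exists (c' *m c); first exact: GL2_mul.
by exists m; rewrite -E' map_mxM -!mulmxA (mulmxA _ M) E -!mulmxA.
Qed.

End QuotientTree.

(** * Assembly of the graph isomorphism *)

Theorem theorem2p9 (k K : fieldType) (iota : {rmorphism k -> K})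
    (K_function_field : function_field iota)
    (k_full : full_constant_field iota)
    (K_genus0 : has_genus iota 0)
    (K_nonrational : ~ rational_function_field iota)
    (infty : place iota) (deg_infty : place_degree infty = 2%N)
    (pi : K) (pi_param : infty pi = 1)
    (Kinf : fieldType) (nuinf : Kinf -> int) (j : {rmorphism K -> Kinf})
    (Kinf_completion : is_completion infty nuinf j)
    (x y : K) (xy_gen : conic_generators infty x y) :
  let G := GL2 (integral_outside infty) in
  let TV := tree_vertices nuinf in
  let TE := tree_edges infty pi nuinf j in
  let p := standard_path pi nuinf j (y / x) in
  [/\ forall n, TV (p n), infinite_path TE p, without_backtracking p &
      @graph_isomorphism (path_graph p) (quotient_graph G (tree_act j) TV TE)
        (vertex_orbit G (tree_act j)) (edge_orbit G (tree_act j))].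
Proof.
move=> G TV TE p.
have [nx ny CE [e [d [rho [sigma [xyE noroot nopoint]]]]]] := conic_generatorsP xy_gen.
have muP := compl_valuation Kinf_completion.
have mu_pi : nuinf (j pi) = 1 by rewrite (nuinf_j Kinf_completion).
have jpi0 : j pi != 0 by rewrite (uniformizer_neq0 muP mu_pi).
pose P := path_rep x y pi j.
have pE n : p n = coset_mx nuinf (P n) by exact: standard_pathE.
have uP n : P n \in unitmx by apply: path_rep_unit Kinf_completion _.
have TVp n : TV (p n) by rewrite pE; exists (P n) => //; split.
have p_inequiv n m g : G g -> tree_act j g (p n) = p m -> n = m.
  rewrite !pE => Gg. by apply: (path_rep_inj nx ny CE xyE noroot pi_param Kinf_completion Gg).
have pathTE : infinite_path TE p.
  move=> n; exists (P n), (P n.+1); split; rewrite ?pE //; try by split.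
  (* Each forward step is of the first adjacency type: z is y / x from v_* to v_0, and 0
     afterwards. *)
  left; case: n => [|n]; [exists (y / x)|exists 0].
    split; first by right; rewrite dvalM ?invr_neq0 ?(gen_x_neq0 nx) ?(gen_y_neq0 ny) //
      ?(dvalV (pval_valuation infty)) ?nx ?ny //; exact: pval_valuation.
    apply/(coset_mxP muP mu_pi); exists 1%:M; first exact: scaled_int1.
    by rewrite /P path_rep1 mulmx1 invmx1 mul1mx.
  split; first by left.
  apply/(coset_mxP muP mu_pi); exists 1%:M; first exact: scaled_int1.
  rewrite mulmx1 /P /path_rep invmx_affine ?expfz_neq0 // mul_affine rmorph0.
  rewrite mul0r oppr0 mulr0 addr0 invr_expz opprK -expfzDr //.
  by rewrite -[in RHS](expr1z (j pi)); congr (affine_mx (_ ^ _) _); lia.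
split=> //.
  by move=> n /(standard_path_inj nx ny CE xyE noroot pi_param Kinf_completion); lia.
split; first split.
- by move=> _ [n _ <-]; exists (p n).
- move=> _ _ /set_mem[n _ <-] /set_mem[m _ <-] E.
  have := @vertex_orbit_self _ _ _ infty _ j (p m); rewrite -/G -E => -[g Gg] /p_inequiv.
  by move=> ->.
- move=> _ [_ [g [ug _ _] <-] <-].
  have [c Gc [n E]] := vertex_orbit_rep nx ny CE xyE noroot pi_param Kinf_completion
      deg_infty nopoint ug.
  exists (p n); first by exists n.
  by rewrite pE -E -tree_act_coset vertex_orbit_eq.
- split.
  + by move=> _ [n _ <-]; exists [set p n; p n.+1].
  + move=> _ _ /set_mem[n _ <-] /set_mem[m _ <-] E.
    have := @edge_orbit_self _ _ _ infty _ j [set p m; p m.+1]; rewrite -/G -E => -[g Gg Eg].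
    (* Inequivalence of path vertices makes [g] preserve indices, so n and n + 1 both lie in {m, m +
       1}. *)
    have mem i : [set p n; p n.+1] (p i) -> i = m \/ i = m.+1.
      move=> ni; have : (tree_act j g @` [set p n; p n.+1]) (tree_act j g (p i)).
        by exists (p i).
      by rewrite Eg => -[] /p_inequiv; auto.
    suff -> : n = m by [].
    have nm : n = m \/ n = m.+1 by apply: mem; left.
    have : n.+1 = m \/ n.+1 = m.+1 by apply: mem; right.
    lia.
  + move=> _ [_ [g1 [g2 [[u1 _ _] [u2 _ _] adj ->]]] <-].
    (* First one endpoint is moved onto the path, then [path_neighbor] moves the whole edge
       there. *)
    have sM := adjacent_scaled_int pi_param Kinf_completion adj.
    have [c Gc [n /(coset_mx_eqP muP mu_pi)[h sh E]]] :=
      vertex_orbit_rep nx ny CE xyE noroot pi_param Kinf_completion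
      deg_infty nopoint u2.
    have sN : scaled_int nuinf 1 (h *m (invmx g2 *m g1)).
      by rewrite -(add0r 1); apply: (scaled_intM muP).
    have [c' Gc' [m Em]] := path_neighbor nx ny CE xyE noroot pi_param Kinf_completion
      deg_infty nopoint n sN.
    exists [set p m; p m.+1]; first by exists m.
    have g1E : map_mx j (c' *m c) *m g1 =
        map_mx j c' *m P n *m (h *m (invmx g2 *m g1)).
      by rewrite map_mxM -!mulmxA (mulmxA (P n)) -E -!mulmxA mulKVmx.
    have g2E : map_mx j (c' *m c) *m g2 = map_mx j c' *m P n *m h.
      by rewrite map_mxM -!mulmxA E.
    rewrite !pE -Em -(edge_orbit_eq j [set coset_mx nuinf g1; coset_mx nuinf g2] (GL2_mul Gc' Gc)).
    congr edge_orbit; rewrite image_setU !image_set1 !tree_act_coset setUC.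
    by rewrite g1E g2E (coset_mx_mulr muP mu_pi _ sh).
(* A vertex of any translate of the edge is a translate of one of its two ends, and so has the orbit
   of that end. *)
move=> _ [n _ <-] /=; apply/seteqP; split=> O.
  move=> [v [_ [g Gg <-] [w ew <-]] <-]; exists w => //.
  by rewrite vertex_orbit_eq.
move=> [v ev <-]; exists v => //; exists [set p n; p n.+1] => //.
exact: edge_orbit_self.
Qed.
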